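(* Let $F$ be a number field, $\mathfrak{p}$ a prime of $F$, $n\in\mathbb{N}$, and let $S_\mathfrak{p}\in\mathrm{SqCl}(F_\mathfrak{p}^\times,\mathcal{O}_\mathfrak{p}^\times)$ with $\mathrm{ord}_\mathfrak{p}(S_\mathfrak{p})=\mathrm{ord}_\mathfrak{p}(\mathfrak{h}_n)$, where $\mathfrak{h}_n=\mathcal{O}_F$ if $n$ is even and $\mathfrak{h}_n=2\mathcal{O}_F$ if $n$ is odd. Then there exists at most one local genus $G_\mathfrak{p}$ of primitive $\mathcal{O}_\mathfrak{p}$-valued quadratic forms in $n$ variables with Hessian determinant $\det_H(G_\mathfrak{p})=S_\mathfrak{p}$.
   Context: $F_\mathfrak{p},\mathcal{O}_\mathfrak{p}$ are the completions of $F$ and its ring of integers $\mathcal{O}_F$ at $\mathfrak{p}$. $\mathrm{SqCl}(F_\mathfrak{p}^\times,\mathcal{O}_\mathfrak{p}^\times)=F_\mathfrak{p}^\times/(\mathcal{O}_\mathfrak{p}^\times)^2$, on which $\mathrm{ord}_\mathfrak{p}$ is well defined. A quadratic form $Q$ in $n$ variables is $\mathcal{O}_\mathfrak{p}$-valued if $Q(\mathcal{O}_\mathfrak{p}^n)\subseteq\mathcal{O}_\mathfrak{p}$, and primitive if in addition its values generate the unit ideal. The Hessian determinant $\det_H(Q)$ is the class in $F_\mathfrak{p}^\times/(\mathcal{O}_\mathfrak{p}^\times)^2$ of the determinant of $(\partial^2Q/\partial x_i\partial x_j)$. A local genus at $\mathfrak{p}$ is an equivalence class of such forms under invertible $\mathcal{O}_\mathfrak{p}$-linear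 changes of variables. *)

(* Defs.v *)
From HB Require Import structures.
From mathcomp Require Import all_boot all_order all_algebra all_field.
From mathcomp Require Import perm ring_quotient.
From mathcomp Require Import boolp classical_sets.
From mathcomp Require Import mpoly.

Set Implicit Arguments.
Unset Strict Implicit.
Unset Printing Implicit Defensive.
Import Order.TTheory GRing.Theory Num.Theory.
Local Open Scope classical_set_scope.
Local Open Scope ring_scope.

Definition integer_pred (F : fieldExtType rat) : {pred F} :=
  fun x => `[< integralOver (intr : int -> F) x >].

Arguments integer_pred : clear implicits.

Fact integer_subring (F : fieldExtType rat) : subring_closed (integer_pred F).
Proof.
split; rewrite /integer_pred ?unfold_in.
- by apply/asboolP; apply: integral1.
- move=> x y /asboolP hx /asboolP hy; apply/asboolP.
  exact: integral_sub.
- move=> x y /asboolP hx /asboolP hy; apply/asboolP.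
  exact: integral_mul.
Qed.

HB.instance Definition _ (F : fieldExtType rat) :=
  GRing.isSubringClosed.Build F (integer_pred F) (integer_subring F).

Record ring_of_integers (F : fieldExtType rat) :=
  RingOfIntegers { integer_val :> F; _ : integer_val \in integer_pred F }.

HB.instance Definition _ (F : fieldExtType rat) :=
  [isSub for @integer_val F].
HB.instance Definition _ (F : fieldExtType rat) :=
  [Choice of ring_of_integers F by <:].
HB.instance Definition _ (F : fieldExtType rat) :=
  [SubChoice_isSubComNzRing of ring_of_integers F by <:].

Definition lin_span (R : nzRingType) (A S : set R) : set R :=
  [set x | exists m (c a : 'I_m -> R),
     (forall i, A (c i) /\ S (a i)) /\ x = \sum_(i < m) c i * a i].

Definition ideal_mul (R : nzRingType) (I J : set R) : set R :=
  lin_span setT [set a * b | a in I & b in J].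

Fixpoint ideal_exp (R : nzRingType) (I : set R) (k : nat) : set R :=
  if k is k'.+1 then ideal_mul I (ideal_exp I k') else setT.

Definition prime_exp F (P : prime_idealr (ring_of_integers F)) :=
  ideal_exp [set x | x \in P].

(* The exponent of [P] in the factorization of the nonzero ideal [I]; it is
   unique since the powers of [P] decrease, and [0] is a junk value. *)
Definition ord_ideal F (P : prime_idealr (ring_of_integers F))
    (I : set (ring_of_integers F)) : nat :=
  xget 0 [set k | I `<=` prime_exp P k /\ ~ (I `<=` prime_exp P k.+1)].

(* [val_ge v N x] means v(x) >= N with the convention v(0) = +oo; the integer
   [v 0] is meaningless and never used. *)
Definition val_ge (K : fieldType) (v : K -> int) (N : int) (x : K) : Prop :=
  x != 0 -> N <= v x.

(* The completion is given by its characterization up to unique isomorphism: a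
   field complete for a discrete valuation, containing F as a dense subfield on
   which the valuation is ord_P (for a nonzero integer [a], ord_P(a) >= k iff
   [a] lies in P^k). *)
Record completion F (P : prime_idealr (ring_of_integers F)) := Completion {
  completion_field :> fieldType;
  completion_emb : {rmorphism F -> completion_field};
  ord : completion_field -> int;
  ordM : forall x y, x != 0 -> y != 0 -> ord (x * y) = ord x + ord y;
  ordD : forall N x y,
    val_ge ord N x -> val_ge ord N y -> val_ge ord N (x + y);
  ord_emb : forall (a : ring_of_integers F) (k : nat), a != 0 ->
    (k%:Z <= ord (completion_emb (val a))) <-> prime_exp P k a;
  completion_dense : forall (x : completion_field) (N : int),
    exists a : F, val_ge ord N (x - completion_emb a);
  completion_complete : forall u : nat -> completion_field,
    (forall N : int, exists m0 : nat, forall i j : nat,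
       (m0 <= i)%N -> (m0 <= j)%N -> val_ge ord N (u i - u j)) ->
    exists l, forall N : int, exists m0 : nat, forall i : nat,
      (m0 <= i)%N -> val_ge ord N (u i - l)
}.

Section Local.
Variables (F : fieldExtType rat) (P : prime_idealr (ring_of_integers F)).
Variable K : completion P.

(* The valuation ring, i.e. the closure of O_F in the completion. *)
Definition Op : set K := [set x | val_ge (@ord F P K) 0 x].

Definition Op_unit : set K := [set x | [/\ x != 0, Op x & Op x^-1]].

Definition sq_class (x : K) : set K := [set x * u ^+ 2 | u in Op_unit].

(* K^* / (Op_unit)^2, whose elements are cosets. *)
Definition SqCl : set (set K) := [set sq_class x | x in [set x | x != 0]].

Definition ord_SqCl (S : set K) : int := ord (xget 0 S).

Lemma val_geM (N N' : int) (x y : K) :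
  val_ge (@ord F P K) N x -> val_ge (@ord F P K) N' y ->
  val_ge (@ord F P K) (N + N') (x * y).
Proof.
move=> hx hy; rewrite /val_ge mulf_eq0 negb_or => /andP[x0 y0].
by rewrite ordM // lerD // ?hx ?hy.
Qed.

Lemma ord_one : ord (1 : K) = 0.
Proof.
apply: (@addrI _ (ord (1 : K))).
by rewrite -ordM ?oner_neq0 // mulr1 addr0.
Qed.

Lemma ord_opp1 : ord (- 1 : K) = 0.
Proof.
have n0 : (- 1 : K) != 0 by rewrite oppr_eq0 oner_neq0.
have := ordM n0 n0; rewrite mulrNN mulr1 ord_one.
by move/esym/eqP; rewrite -mulr2n mulrn_eq0 /= => /eqP.
Qed.

Lemma Op1 : Op 1.
Proof. by move=> _; rewrite ord_one. Qed.

Lemma OpN1 : Op (- 1).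
Proof. by move=> _; rewrite ord_opp1. Qed.

Lemma OpM x y : Op x -> Op y -> Op (x * y).
Proof. exact: (@val_geM 0 0). Qed.

Lemma OpD x y : Op x -> Op y -> Op (x + y).
Proof. exact: ordD. Qed.

Lemma Op_det n (M : 'M[K]_n) : (forall i j, Op (M i j)) -> Op (\det M).
Proof.
move=> hM; rewrite /determinant.
apply: (big_ind Op); [by move=> /eqP | exact: OpD |] => s _.
apply: OpM; first by case: (odd_perm s); rewrite ?expr1 ?expr0; [exact: OpN1|exact: Op1].
by apply: (big_ind Op); [exact: Op1 | exact: OpM |].
Qed.

Lemma Op_unitM x y : Op_unit x -> Op_unit y -> Op_unit (x * y).
Proof.
move=> [x0 hx hx'] [y0 hy hy']; split; first by rewrite mulf_neq0.
  exact: OpM.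
by rewrite invfM; apply: OpM.
Qed.

Lemma Op_unitV x : Op_unit x -> Op_unit x^-1.
Proof. by move=> [x0 hx hx']; split; rewrite ?invrK ?invr_eq0. Qed.

Lemma ord_unit u : Op_unit u -> ord u = 0.
Proof.
move=> [u0 /(_ u0) hu hu']; apply/eqP; rewrite eq_le hu andbT.
have v0 : u^-1 != 0 by rewrite invr_eq0.
by rewrite -[leRHS]ord_one -(mulfV u0) ordM // lerDl hu'.
Qed.

Lemma sq_classM (x u : K) : Op_unit u -> sq_class (x * u ^+ 2) = sq_class x.
Proof.
move=> hu; have [u0 _ _] := hu.
apply/seteqP; split=> _ [w hw <-].
  by exists (u * w); [exact: Op_unitM | rewrite exprMn mulrA].
exists (u^-1 * w); first by apply: Op_unitM => //; exact: Op_unitV.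
by rewrite exprMn mulrA -(mulrA x) exprVn divff ?expf_neq0 // mulr1.
Qed.

Lemma sq_class_refl (x : K) : sq_class x x.
Proof.
exists 1; last by rewrite expr1n mulr1.
by split; rewrite ?invr1 ?oner_neq0 //; exact: Op1.
Qed.

Lemma ord_SqClE (S : set K) (x : K) : SqCl S -> S x -> ord_SqCl S = ord x.
Proof.
move=> [y /= y0 <-].
suff h z : sq_class y z -> ord z = ord y.
  by move=> hx; rewrite /ord_SqCl (h x hx) h //; apply: xgetI hx.
move=> [u hu <-]; have [u0 _ _] := hu.
by rewrite expr2 !ordM ?mulf_neq0 // (ord_unit hu) // !addr0.
Qed.

Section Forms.
Variable n : nat.
Implicit Types (Q : {mpoly K[n]}) (M : 'M[K]_n).

Definition form_values Q : set K :=
  [set Q.@[v] | v in [set v : 'I_n -> K | forall i, Op (v i)]].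

Definition Op_valued Q : Prop := form_values Q `<=` Op.

Definition primitive Q : Prop :=
  Op_valued Q /\ lin_span Op (form_values Q) = Op.

(* The second partial derivatives of a quadratic form are constants, so they
   are read off at the origin. *)
Definition hessian Q : 'M[K]_n :=
  \matrix_(i, j) (Q^`M(i)^`M(j)).@[fun=> 0].

(* A form with singular Hessian matrix gets {0}, which is not in [SqCl]. *)
Definition det_H Q : set K := sq_class (\det (hessian Q)).

Definition GL_Op : set 'M[K]_n :=
  [set M | [/\ M \in unitmx, forall i j, Op (M i j)
             & forall i j, Op (invmx M i j)]].

(* The form Q(M x). *)
Definition form_subst Q M : {mpoly K[n]} :=
  Q \mPo [tuple \sum_(j < n) M i j *: 'X_j | i < n].

Definition genus Q : set {mpoly K[n]} := [set form_subst Q M | M in GL_Op].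

Definition primitive_genus : set (set {mpoly K[n]}) :=
  [set genus Q | Q in [set Q | Q \is 2.-homog /\ primitive Q]].

(* The common Hessian determinant of the members of G, see [det_H_genusE]. *)
Definition det_H_genus (G : set {mpoly K[n]}) : set K := det_H (xget 0 G).

Lemma mderivXU (R : comNzRingType) m (i j : 'I_m) :
  ('X_j : {mpoly R[m]})^`M(i) = ((j == i)%:R)%:MP.
Proof.
rewrite mderivX mnm1E; case: eqVneq => [->|_]; last by rewrite scale0r.
by rewrite scale1r -[X in (X - _)%MM]add0m addmK mpolyX0.
Qed.

Lemma mderiv_comp (p : {mpoly K[n]}) (lq : n.-tuple {mpoly K[n]}) i :
  (p \mPo lq)^`M(i) = \sum_(k < n) (p^`M(k) \mPo lq) * (tnth lq k)^`M(i).
Proof.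
pose D (q : {mpoly K[n]}) := (q \mPo lq)^`M(i) =
  \sum_(k < n) (q^`M(k) \mPo lq) * (tnth lq k)^`M(i).
have DC c : D c%:MP.
  rewrite /D comp_mpolyC mderivC big1 // => k _.
  by rewrite mderivC comp_mpoly0 mul0r.
have DM q r : D q -> D r -> D (q * r).
  rewrite /D => hq hr; rewrite rmorphM /= mderivM hq hr mulr_suml mulr_sumr.
  rewrite -big_split; apply: eq_bigr => k _ /=.
  rewrite mderivM rmorphD /= !rmorphM /= mulrDl; congr (_ + _).
    by rewrite mulrAC.
  by rewrite mulrA.
have DX j : D 'X_j.
  rewrite /D comp_mpolyXU -tnth_nth (bigD1 j) //= big1 => [|k kj].
    by rewrite mderivXU eqxx comp_mpolyC mul1r addr0.
  by rewrite mderivXU eq_sym (negPf kj) comp_mpolyC mul0r.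
rewrite -/(D p); elim/mpolyind: p => [|c m p _ _ hp]; first exact: (DC 0).
rewrite /D comp_mpolyD mderivD hp.
have -> : (c *: 'X_[m] \mPo lq)^`M(i) =
    \sum_(k < n) ((c *: 'X_[m])^`M(k) \mPo lq) * (tnth lq k)^`M(i).
  rewrite -mul_mpolyC -/(D _); apply: (DM); first exact: (DC).
  rewrite mpolyXE_id; apply: (big_ind D) => [|q r|j _]; first exact: (DC 1).
    exact: DM.
  by elim: (m j) => [|d hd]; rewrite ?expr0 ?exprS; [exact: (DC 1)|exact: DM].
rewrite -big_split; apply: eq_bigr => k _ /=.
by rewrite mderivD comp_mpolyD mulrDl.
Qed.

Lemma hessian_subst Q M : hessian (form_subst Q M) = M^T *m hessian Q *m M.
Proof.
pose lq : n.-tuple {mpoly K[n]} := [tuple \sum_(j < n) M i j *: 'X_j | i < n].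
have dlq k i : (tnth lq k)^`M(i) = (M k i)%:MP.
  rewrite tnth_mktuple (raddf_sum (mderiv i)) /= (bigD1 i) //= big1 => [|j ji].
    by rewrite mderivZ mderivXU eqxx addr0 alg_mpolyC.
  by rewrite mderivZ mderivXU (negPf ji) scaler0.
have lq0 p : (p \mPo lq).@[fun=> 0] = p.@[fun=> 0].
  rewrite comp_mpoly_meval; apply: meval_eq => k.
  rewrite tnth_mktuple raddf_sum /= big1 // => j _.
  by rewrite mevalZ mevalXU mulr0.
apply/matrixP => i j; rewrite !mxE.
rewrite /form_subst -/lq mderiv_comp !(raddf_sum (mderiv j)) raddf_sum /=.
under eq_bigr => k _.
  rewrite dlq mulrC mderiv_mulC mderiv_comp mevalM mevalC raddf_sum /=.
  under eq_bigr => l _ do rewrite dlq mevalM mevalC lq0.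
  over.
under [RHS]eq_bigr => l _ do rewrite mxE mulr_suml.
rewrite exchange_big /=; apply: eq_bigr => k _; rewrite mulr_sumr.
by apply: eq_bigr => l _; rewrite !mxE mulrA.
Qed.

Lemma det_H_subst Q M : GL_Op M -> det_H (form_subst Q M) = det_H Q.
Proof.
move=> [uM hM hM']; rewrite /det_H hessian_subst !det_mulmx det_tr.
rewrite mulrAC mulrC -expr2; apply: sq_classM; split; last 1 first.
- by rewrite -det_inv; apply: Op_det.
- by rewrite -unitfE -unitmxE.
- exact: Op_det.
Qed.

Lemma det_H_genusE Q Q' : genus Q Q' -> det_H_genus (genus Q) = det_H Q'.
Proof.
suff h Q1 : genus Q Q1 -> det_H Q1 = det_H Q.
  by move=> hQ; rewrite /det_H_genus (h Q' hQ) h //; apply: xgetI hQ.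
by move=> [M hM <-]; apply: det_H_subst.
Qed.

End Forms.

End Local.

Definition h_ideal F (n : nat) : set (ring_of_integers F) :=
  if odd n then [set 2 * a | a in setT] else setT.

(* Main.v *)
(** The residue field is finite and the valuation ring [Op] is Henselian. If
[n >= 3], Chevalley-Warning gives a nontrivial zero of the form modulo the prime;
the condition on the determinant makes this zero smooth, so that it lifts to a
primitive isotropic vector, which splits off a hyperbolic plane. By induction
only [n <= 2] is left. A binary form with unit Hessian determinant represents 1
(apply Chevalley-Warning to the form minus a square, then lift), hence is
equivalent to [x^2 + b x y + c y^2]; two such forms with the same discriminant
[b^2 - 4 c] differ by a substitution [x -> x + s y], because [(b' - b) / 2] is
integral over [Op]. No case distinction on the residue characteristic is needed.
The residue field is finite because each of its elements is a root of a nonzero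
polynomial over the prime field of degree at most [\dim F]: approximate by an
element of [F] and reduce its primitive integral minimal polynomial. *)

Require Import Defs.
From HB Require Import structures.
From mathcomp Require Import all_boot all_order all_algebra all_field.
From mathcomp Require Import perm ring_quotient.
From mathcomp Require Import boolp classical_sets.
From mathcomp Require Import mpoly zify ring.

Set Implicit Arguments.
Unset Strict Implicit.
Unset Printing Implicit Defensive.
Import Order.TTheory GRing.Theory Num.Theory.
Local Open Scope classical_set_scope.
Local Open Scope ring_scope.

(** * Quadratic forms over finite fields *)

Definition qval (R : comNzRingType) n (A : 'M[R]_n) (x : 'cV[R]_n) : R :=
  (x^T *m A *m x) 0 0.

Lemma qvalE (R : comNzRingType) n (A : 'M[R]_n) (x : 'cV[R]_n) :
  qval A x = \sum_i \sum_j A i j * x i 0 * x j 0.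
Proof.
rewrite /qval mxE exchange_big /=; apply: eq_bigr => j _.
rewrite mxE mulr_suml; apply: eq_bigr => i _.
by rewrite mxE (mulrC (x i 0)).
Qed.

Section ChevalleyWarning.
Variable k : finFieldType.
Local Notation q := #|k|.

(** Translation by 1 permutes the field, so it leaves the sum of all elements unchanged while adding
    [q%:R] to it. *)
Lemma card_fin_field0 : (q%:R : k) = 0.
Proof.
have h : \sum_(y : k) (y + 1) = \sum_(y : k) y.
  rewrite (reindex_inj (@addIr _ (-1))).
  by apply: eq_bigr => y _; rewrite addrNK.
move: h; rewrite big_split /= -[RHS]addr0 => /addrI.
by rewrite sumr_const.
Qed.

(** Multiplication by a nonzero [z] permutes the field and scales the sum by [z ^+ i]. For [i > 0]
    some [z] has [z ^+ i != 1], because ['X^i - 1] has at most [i < q.-1] roots; for [i = 0] the sum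
    is [q%:R]. *)
Lemma sum_expr_fin_field i : (i < q.-1)%N -> \sum_(y : k) y ^+ i = 0.
Proof.
case: i => [|i] hi; first by rewrite sumr_const -[RHS]card_fin_field0.
have [z z0 zi] : exists2 z : k, z != 0 & z ^+ i.+1 != 1.
  case: (boolP [exists z : k, (z != 0) && (z ^+ i.+1 != 1)]).
    by case/existsP=> z /andP[]; exists z.
  rewrite negb_exists => /forallP h; exfalso.
  have p0 : ('X^(i.+1) - 1%:P : {poly k}) != 0.
    by rewrite -size_poly_eq0 size_XnsubC.
  have := @max_poly_roots _ _ [seq z <- enum k | z != 0] p0.
  rewrite size_XnsubC // => H; have := H _ _.
  have -> : size [seq z <- enum k | z != 0] = q.-1.
    by rewrite -(cardC1 (0 : k)) cardE enumT.
  rewrite ltnS leqNgt hi => H1.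
  suff : false by []. apply: H1.
    apply/allP => z; rewrite mem_filter => /andP[z0 _].
    have := h z; rewrite z0 /= negbK => /eqP e.
    by rewrite rootE !hornerE e subrr.
  by rewrite filter_uniq ?enum_uniq.
have h : \sum_(y : k) y ^+ i.+1 = z ^+ i.+1 * \sum_(y : k) y ^+ i.+1.
  rewrite {1}(reindex_inj (mulfI z0)) mulr_sumr.
  by apply: eq_bigr => y _; rewrite exprMn.
apply/eqP; move/eqP: h; rewrite -subr_eq0 -{1}[\sum_y _]mul1r -mulrBl mulf_eq0.
by rewrite subr_eq0 eq_sym (negPf zi).
Qed.

(** The sum factors into power sums, one per variable, whose exponents [e i] are the sizes of the
    fibres of [f]. They add up to [m], so one of them is below [q.-1] and its power sum vanishes. *)
Lemma sum_monomial n m (f : 'I_m -> 'I_n) :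
  (m < n * q.-1)%N -> \sum_(x : {ffun 'I_n -> k}) \prod_t x (f t) = 0.
Proof.
move=> hm; pose e i := #|[pred t | f t == i]|.
under eq_bigr => x _.
  rewrite (partition_big f xpredT) //=.
  under eq_bigr => i _.
    rewrite (eq_bigr (fun=> x i)); last by move=> t /eqP->.
    rewrite prodr_const -/(e i).
    over.
  over.
rewrite -(bigA_distr_bigA (fun i y => y ^+ e i)).
have [i hi] : exists i, (e i < q.-1)%N.
  case: (boolP [exists i, (e i < q.-1)%N]) => [/existsP //|].
  rewrite negb_exists => /forallP h; move: hm; rewrite ltnNge => /negP[].
  have -> : m = (\sum_i e i)%N.
    rewrite -[LHS]card_ord -sum1_card (partition_big f xpredT) //=.
    by apply: eq_bigr => i _; rewrite sum1_card.
  rewrite -[X in (X * _)%N]card_ord -sum_nat_const; apply: leq_sum => i _.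
  by rewrite leqNgt.
by rewrite (bigD1 i) //= sum_expr_fin_field ?mul0r.
Qed.

(** Chevalley-Warning for one quadric: without a nontrivial zero, [qval A x ^+ q.-1] would be the
    indicator of [x != 0], with sum [q ^ n - 1 = -1] in [k]. Yet this power expands into monomials
    of degree [2 * q.-1 < n * q.-1], whose sums vanish. *)
Lemma qform_isotropic n (A : 'M[k]_n) : (2 < n)%N ->
  exists2 x : 'cV[k]_n, x != 0 & qval A x = 0.
Proof.
move=> n2.
have q1 : (0 < q.-1)%N by rewrite -subn1 subn_gt0 finNzRing_gt1.
pose v (x : {ffun 'I_n -> k}) : 'cV[k]_n := \col_i x i.
have s0 : \sum_(x : {ffun 'I_n -> k}) qval A (v x) ^+ q.-1 = 0.
  pose B (ij : 'I_n * 'I_n) (x : {ffun 'I_n -> k}) := A ij.1 ij.2 * x ij.1 * x ij.2.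
  have E x : qval A (v x) ^+ q.-1 =
      \sum_(f : {ffun 'I_q.-1 -> 'I_n * 'I_n}) \prod_t B (f t) x.
    rewrite qvalE pair_big /= -(bigA_distr_bigA (fun _ ij => B ij x)) /=.
    rewrite prodr_const card_ord; congr (_ ^+ _).
    by apply: eq_bigr => ij _; rewrite !mxE.
  under eq_bigr do rewrite E.
  rewrite exchange_big big1 //= => f _.
  (* The two variables of each of the [q.-1] factors are listed in one sequence, first components
     first. *)
  pose g (t : 'I_(q.-1 + q.-1)) :=
    match split t with inl a => (f a).1 | inr b => (f b).2 end.
  have F x : \prod_t B (f t) x = (\prod_t A (f t).1 (f t).2) * \prod_t x (g t).
    rewrite big_split_ord /= mulrA; rewrite /B !big_split /=; congr (_ * _ * _).
      by apply: eq_bigr => t _; rewrite /g (unsplitK (inl t)).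
    by apply: eq_bigr => t _; rewrite /g (unsplitK (inr t)).
  under eq_bigr do rewrite F.
  rewrite -mulr_sumr sum_monomial ?mulr0 //.
  by rewrite addnn -mul2n ltn_pmul2r.
case: (boolP [exists x : 'cV[k]_n, (x != 0) && (qval A x == 0)]).
  by case/existsP=> x /andP[x0 /eqP]; exists x.
rewrite negb_exists => /forallP h'; exfalso.
have {h'}h x : x != 0 -> qval A x != 0 by move=> x0; have := h' x; rewrite x0.
move: s0; rewrite (bigD1 [ffun=> 0]) //=.
have -> : qval A (v [ffun=> 0]) = 0.
  have -> : v [ffun=> 0] = 0 by apply/matrixP => i j; rewrite !mxE ffunE.
  by rewrite /qval mulmx0 mxE.
rewrite expr0n -[q.-1]prednK //= add0r.
rewrite (eq_bigr (fun=> 1)) => [|x x0]; last first.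
  rewrite prednK //; have : qval A (v x) != 0.
    apply: h; apply: contraNneq x0 => vx.
    by apply/eqP/ffunP => i; move/matrixP/(_ i 0): vx; rewrite !mxE ffunE.
  move=> qx; rewrite -[_ ^+ _](mulKf qx) -exprS.
  by rewrite prednK ?(ltnW (finNzRing_gt1 _)) // expf_card mulVf.
rewrite sumr_const => /eqP.
rewrite cardC1 card_ffun card_ord => H.
have : ((q ^ n)%N%:R : k) = 1.
  rewrite -[(q ^ n)%N]prednK ?expn_gt0 ?(ltnW (finNzRing_gt1 _)) //.
  by rewrite mulrSr (eqP H) add0r.
rewrite natrX card_fin_field0 expr0n; case: n n2 {A v h H} => //= n _ /eqP.
by rewrite eq_sym oner_eq0.
Qed.
End ChevalleyWarning.

(** * Congruence of symmetric matrices *)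

(** The points moved by [g] form pairs; [enum_rank] serves to choose one member of each pair. *)
Lemma sum_involutive (V : nmodType) (I : finType) (g : I -> I) (f : I -> V) :
  involutive g -> (forall i, f (g i) = f i) ->
  \sum_i f i = \sum_(i | g i == i) f i
     + (\sum_(i | (enum_rank i < enum_rank (g i))%N) f i) *+ 2.
Proof.
move=> gK fg; rewrite (bigID (fun i => g i == i)) /=; congr (_ + _).
rewrite (bigID (fun i => (enum_rank i < enum_rank (g i))%N)) /= mulr2n.
have ne i : (enum_rank i < enum_rank (g i))%N -> g i != i.
  by apply: contraTneq => ->; rewrite ltnn.
congr (_ + _).
  by apply: eq_bigl => i; case: ltnP => [/ne ->|]; rewrite ?andbF.
rewrite (reindex_inj (can_inj gK)); apply: eq_big => [i|i _]; last exact: fg.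
rewrite gK -leqNgt leq_eqVlt eq_sym andb_orr.
case: ltngtP => /= [/ne ->//|_|h]; rewrite ?andbF ?orbF ?andbT //.
by apply/eqP; rewrite -(enum_rank_inj (ord_inj h)).
Qed.

(** By this pairing, the number of fixed points has the parity of [#|I|]. *)
Lemma involutive_fixpoint (I : finType) (g : I -> I) :
  involutive g -> odd #|I| -> exists i, g i = i.
Proof.
move=> gK; rewrite -sum1_card (sum_involutive gK) // oddD.
rewrite (_ : odd (_ *+ 2) = false) ?addbF; last first.
  by rewrite mulr2n oddD addbb.
rewrite sum1_card => /odd_gt0/card_gt0P[i].
by move/eqP; exists i.
Qed.

(* As the matrix is symmetric, inverse permutations have the same term in the
   Leibniz formula, so only the terms of involutions are not paired up; an
   involution of an odd set has a fixed point [i], which provides the factor 2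
   as a diagonal coefficient [2 * A i i]. *)
Lemma det_even_odd (R : comNzRingType) (S : nzRingType) (f : {rmorphism R -> S})
    n (A : 'M[R]_n) i0 :
  odd n -> f (A i0 i0) = 0 -> (forall j, f (A i0 j + A j i0) = 0) ->
  exists2 t, f t = 0 & \det (A + A^T) = 2%:R * t.
Proof.
move=> n_odd f0 fj; set H := A + A^T.
have HE i j : H i j = A i j + A j i by rewrite !mxE.
have Hsym i j : H i j = H j i by rewrite !HE addrC.
(* The morphism [f] stands for reduction modulo the prime. Besides the factor 2, each contribution
   must keep a factor from row [i0], which [f] kills. *)
pose I2 x := exists2 t, f t = 0 & x = 2%:R * t.
have I2D x y : I2 x -> I2 y -> I2 (x + y).
  move=> [s s0 ->] [t t0 ->]; exists (s + t); first by rewrite rmorphD /= s0 t0 addr0.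
  by rewrite mulrDr.
have I2M x y : I2 x -> I2 (y * x).
  move=> [s s0 ->]; exists (y * s); first by rewrite rmorphM /= s0 mulr0.
  by rewrite mulrCA.
pose F (s : 'S_n) := (-1) ^+ s * \prod_i H i (s i).
rewrite -/(I2 _) /determinant -/(F _) (@sum_involutive _ _ (fun s : 'S_n => s^-1)%g) /=.
- apply: (I2D); last first.
    rewrite -mulr_natl; eexists; last reflexivity.
    rewrite rmorph_sum big1 //= => s _.
    by rewrite (bigD1 i0) //= !rmorphM /= HE fj mul0r mulr0.
  apply: (big_ind I2) => //; first by exists 0; rewrite ?rmorph0 ?mulr0.
  move=> s /eqP si; apply: (I2M).
  have sK : involutive s by move=> i; rewrite -{1}si permK.
  rewrite (bigD1 i0) //= mulrC.
  (* If [i0] is fixed, its diagonal entry [2 * A i0 i0] provides both factors. Otherwise 2 comes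
     from another fixed point [i], and the factor killed by [f] is [H i0 (s i0)]. *)
  have [si0|si0] := eqVneq (s i0) i0.
    by apply: I2M; rewrite si0 HE -mulr2n -mulr_natl; exists (A i0 i0).
  have [i sii] := involutive_fixpoint sK (etrans (congr1 odd (card_ord n)) n_odd).
  rewrite (bigD1 i) /=; last by apply: contraNneq si0 => <-; rewrite sii.
  rewrite sii HE -mulr2n -mulr_natl mulrAC -!mulrA; exists (A i i * (H i0 (s i0) *
     \prod_(j | (j != i0) && (j != i)) H j (s j))) => //.
  by rewrite !rmorphM /= HE fj mul0r mulr0.
- exact: invgK.
move=> s; rewrite /F odd_permV; congr (_ * _).
rewrite (reindex_inj (@perm_inj _ s)); apply: eq_bigr => i _.
by rewrite permK Hsym.
Qed.

Section Congruence.
Variable R : comUnitRingType.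

Definition congruent n (H H' : 'M[R]_n) :=
  exists2 M, M \in unitmx & H' = M^T *m H *m M.

(* [A + A^T] is the Hessian matrix of the form x^T A x. *)
Definition even_mx n (H : 'M[R]_n) := exists A, H = A + A^T.

Lemma congruent_trans n (H1 H2 H3 : 'M[R]_n) :
  congruent H1 H2 -> congruent H2 H3 -> congruent H1 H3.
Proof.
move=> [M uM ->] [N uN ->]; exists (M *m N); first by rewrite unitmx_mul uM.
by rewrite trmx_mul !mulmxA.
Qed.

Lemma congruent_sym n (H1 H2 : 'M[R]_n) : congruent H1 H2 -> congruent H2 H1.
Proof.
move=> [M uM ->]; exists (invmx M); first by rewrite unitmx_inv.
rewrite !mulmxA -trmx_mul mulmxV // trmx1 mul1mx -mulmxA mulmxV //.
by rewrite mulmx1.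
Qed.

Lemma congruent_det n (H1 H2 : 'M[R]_n) : congruent H1 H2 ->
  exists2 m, m \is a GRing.unit & \det H2 = \det H1 * m ^+ 2.
Proof.
move=> [M uM ->]; exists (\det M); first by rewrite -unitmxE.
by rewrite !det_mulmx det_tr mulrAC mulrC expr2.
Qed.

Lemma even_congruent n (A M : 'M[R]_n) :
  M^T *m (A + A^T) *m M = (M^T *m A *m M) + (M^T *m A *m M)^T.
Proof. by rewrite mulmxDr mulmxDl !trmx_mul trmxK !mulmxA. Qed.

Lemma congruent_even n (H1 H2 : 'M[R]_n) :
  congruent H1 H2 -> even_mx H1 -> even_mx H2.
Proof.
move=> [M uM ->] [A ->]; exists (M^T *m A *m M); exact: even_congruent.
Qed.

Lemma congruent_block n m (U U' : 'M[R]_n) (H H' : 'M[R]_m) :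
  congruent U U' -> congruent H H' ->
  congruent (block_mx U 0 0 H) (block_mx U' 0 0 H').
Proof.
move=> [M uM ->] [N uN ->]; exists (block_mx M 0 0 N).
  by rewrite unitmxE det_ublock unitrM -!unitmxE uM.
by rewrite tr_block_mx !trmx0 !mulmx_block !(mulmx0, mul0mx, addr0, add0r).
Qed.

Lemma congruent_refl n (H : 'M[R]_n) : congruent H H.
Proof. by exists 1%:M; rewrite ?unitmx1 // trmx1 mul1mx mulmx1. Qed.

Lemma congruent_perm n (s : 'S_n) (H : 'M[R]_n) :
  congruent H (row_perm s (col_perm s H)).
Proof.
exists (perm_mx s^-1)%g; first exact: unitmx_perm.
by rewrite row_permE col_permE tr_perm_mx invgK mulmxA.
Qed.

(** Block Gaussian elimination: a unipotent change of basis clears [C] and leaves the Schur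
    complement of [U]. *)
Lemma congruent_schur n m (U : 'M[R]_n) (C : 'M[R]_(n, m)) (D : 'M[R]_m) :
  U^T = U -> U \in unitmx ->
  congruent (block_mx U C C^T D) (block_mx U 0 0 (D - C^T *m invmx U *m C)).
Proof.
move=> sU uU; exists (block_mx 1%:M (- (invmx U *m C)) 0 1%:M).
  by rewrite unitmxE det_ublock !det1 mulr1 unitr1.
rewrite tr_block_mx !trmx0 !trmx1 linearN /= trmx_mul trmx_inv sU.
rewrite !mulmx_block !(mul0mx, mulmx0, mul1mx, mulmx1, addr0, add0r).
rewrite mulmxN mulNmx mulmxA mulmxV // mul1mx addNr.
rewrite !mulNmx mulmxKV // addNr mulmxN mul0mx oppr0 add0r.
by rewrite addrC.
Qed.

(** The [i]-th basis vector can be replaced by [v]; a transposition then moves it to the front. *)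
Lemma exists_basis n (v : 'cV[R]_n.+1) i : v i 0 \is a GRing.unit ->
  exists2 M, M \in unitmx & M *m delta_mx 0 0 = v.
Proof.
move=> ui; pose e : 'cV[R]_n.+1 := delta_mx i 0.
have ev (x : 'cV[R]_n.+1) : e^T *m x = (x i 0)%:M.
  by rewrite trmx_delta -rowE [LHS]mx11_scalar !mxE.
pose M := 1%:M + (v - e) *m e^T.
exists (M *m tperm_mx 0 i).
  rewrite unitmx_mul unitmx_perm andbT.
  (* The inverse of a rank one perturbation of the identity, by the Sherman-Morrison formula; its
     denominator is [v i 0]. *)
  suff /mulmx1_unit[] : M *m (1%:M - (v i 0)^-1 *: ((v - e) *m e^T)) = 1%:M by [].
  rewrite mulmxDl mulmxBr mulmx1 mul1mx mulmxBr mulmx1 -scalemxAr.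
  rewrite -!mulmxA (mulmxA e^T) ev mul_scalar_mx -scalemxAr scalerA.
  rewrite !mxE !eqxx /= mulrBr mulr1 mulVr // -addrA [X in _ + X](_ : _ = 0) ?addr0 //.
  by rewrite scalerBl scale1r opprB [_ + (_ - _)]addrCA subrr addr0 addNr.
have -> : v = M *m e.
  by rewrite mulmxDl mul1mx -mulmxA ev !mxE !eqxx mulmx1 addrC subrK.
rewrite -mulmxA -xrowE; congr (_ *m _); apply/matrixP => a b.
by rewrite !mxE -(inj_eq (@perm_inj _ (tperm 0 i))) tpermK tpermL.
Qed.
End Congruence.

Open Scope ring_scope.

(** * Matrices of size two *)

Section TwoByTwo.
Variable R : comNzRingType.
Implicit Types a b c d : R.

Definition mx22 a b c d : 'M[R]_2 :=
  \matrix_(i, j) if i == 0 then (if j == 0 then a else b)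
                 else (if j == 0 then c else d).

Lemma matrix2P (A B : 'M[R]_2) :
  A 0 0 = B 0 0 -> A 0 1 = B 0 1 -> A 1 0 = B 1 0 -> A 1 1 = B 1 1 -> A = B.
Proof.
move=> h00 h01 h10 h11; apply/matrixP=> i j.
have E (l : 'I_2) : l = 0 \/ l = 1.
  by case: l => [[|[|l]] hl] //; [left|right]; apply/val_inj.
by case: (E i) (E j) => -> [] ->.
Qed.

Lemma tr_mx22 a b c d : (mx22 a b c d)^T = mx22 a c b d.
Proof. by apply: matrix2P; rewrite !mxE. Qed.

Lemma mul_mx22 a b c d a' b' c' d' :
  mx22 a b c d *m mx22 a' b' c' d' =
  mx22 (a * a' + b * c') (a * b' + b * d') (c * a' + d * c') (c * b' + d * d').
Proof.
by apply: matrix2P; rewrite !mxE !big_ord_recl big_ord0 addr0 !mxE.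
Qed.

Lemma det_mx22 a b c d : \det (mx22 a b c d) = a * d - b * c.
Proof.
rewrite (expand_det_row _ 0) !big_ord_recl big_ord0 addr0 /cofactor !det_mx11 !mxE /=.
rewrite /bump /=. ring.
Qed.
End TwoByTwo.

(** * Semiregular forms over Henselian local rings *)

Definition bilin (R : comNzRingType) n (H : 'M[R]_n) (x y : 'cV[R]_n) : R :=
  (x^T *m H *m y) 0 0.

(** Along a line the form is a polynomial of degree at most two in [t], with a value of the polar
    form as linear coefficient; Hensel's lemma will be applied to it. *)
Lemma qvalDZ (R : comNzRingType) n (A : 'M[R]_n) x y (t : R) :
  qval A (x + t *: y) = qval A x + bilin (A + A^T) x y * t + qval A y * t ^+ 2.
Proof.
rewrite /qval /bilin.
have -> : (x + t *: y)^T = x^T + t *: y^T by rewrite linearD linearZ.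
rewrite !(mulmxDl, mulmxDr).
have -> : x^T *m A^T *m y = (y^T *m A *m x)^T.
  by rewrite !trmx_mul trmxK mulmxA.
rewrite -!scalemxAl -!scalemxAr.
move: (x^T *m A *m x) (x^T *m A *m y) (y^T *m A *m x) (y^T *m A *m y) => a b c d.
by rewrite !mxE; ring.
Qed.

Lemma qvalZ (R : comNzRingType) n (A : 'M[R]_n) x (t : R) :
  qval A (t *: x) = t ^+ 2 * qval A x.
Proof.
have xt : (t *: x)^T = t *: x^T by rewrite linearZ.
by rewrite /qval xt -scalemxAr -!scalemxAl scalerA -expr2 mxE.
Qed.

Lemma map_qval (R S : comNzRingType) (f : {rmorphism R -> S}) n (A : 'M[R]_n) x :
  f (qval A x) = qval (map_mx f A) (map_mx f x).
Proof. by rewrite /qval map_trmx -!map_mxM [RHS]mxE. Qed.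

Lemma qval_congr (R : comNzRingType) n (A M : 'M[R]_n) x :
  qval (M^T *m A *m M) x = qval A (M *m x).
Proof. by rewrite /qval trmx_mul !mulmxA. Qed.

Lemma bilin_congr (R : comNzRingType) n (A M : 'M[R]_n) x y :
  bilin (M^T *m A *m M) x y = bilin A (M *m x) (M *m y).
Proof. by rewrite /bilin trmx_mul !mulmxA. Qed.

Lemma bilin_delta (R : comNzRingType) n (A : 'M[R]_n) i j :
  bilin A (delta_mx i 0) (delta_mx j 0) = A i j.
Proof. by rewrite /bilin trmx_delta -rowE -colE !mxE. Qed.

Section Henselian.
Variables (R : idomainType) (k : finFieldType) (f : {rmorphism R -> k}).
Hypothesis two_neq0 : (2%:R : R) != 0.
Hypothesis f_surj : forall y, exists x, f x = y.
Hypothesis f_unit : forall x, f x != 0 -> x \is a GRing.unit.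
(** Hensel's lemma in degree two at the approximate root 0, where the derivative is [b]. *)
Hypothesis hensel2 : forall a b c, f a = 0 -> b \is a GRing.unit ->
  exists2 t, f t = 0 & a + b * t + c * t ^+ 2 = 0.
(* [x / 2] is a root of the monic polynomial [s ^+ 2 + y * s - z]. *)
Hypothesis half_closed : forall x y z : R,
  x ^+ 2 + 2%:R * x * y = 4%:R * z -> exists s, x = 2%:R * s.

Lemma unit_f x : x \is a GRing.unit -> f x != 0.
Proof. by move=> ux; rewrite -unitfE rmorph_unit. Qed.

(* In odd dimension the Hessian determinant is always divisible by 2, and the
   condition says that the half-determinant is a unit. *)
Definition semiregular n (H : 'M[R]_n) :=
  exists2 u, u \is a GRing.unit & \det H = 2%:R ^+ odd n * u.

Lemma semiregular_sq n (H H' : 'M[R]_n) u : u \is a GRing.unit ->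
  \det H' = \det H * u ^+ 2 -> semiregular H -> semiregular H'.
Proof.
move=> uu e [w uw ew]; exists (w * u ^+ 2); first by rewrite unitrM uw unitrX.
by rewrite e ew mulrA.
Qed.

Lemma semiregular_congruent n (H H' : 'M[R]_n) :
  congruent H H' -> semiregular H -> semiregular H'.
Proof. by move=> /congruent_det[m um e]; exact: semiregular_sq um e. Qed.

Lemma unit_coord n (v : 'cV[R]_n) : map_mx f v != 0 ->
  exists i, v i 0 \is a GRing.unit.
Proof.
case: (boolP [forall i, f (v i 0) == 0]) => [/forallP h /eqP[]|].
  by apply/colP => i; rewrite !mxE; apply/eqP.
by rewrite negb_forall => /existsP[i /f_unit ui] _; exists i.
Qed.

(** Suppose that [f] kills the whole first row. In even dimension the determinant is then a nonunit;
    in odd dimension [det_even_odd] shows that the half-determinant is one, since [f] also kills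
    [A 0 0]. Both contradict semiregularity. *)
Lemma exists_pairing_first n (A : 'M[R]_n.+1) :
  semiregular (A + A^T) -> (f (A 0 0) = 0 \/ ~~ odd n.+1) ->
  exists j, (A + A^T) 0 j \is a GRing.unit.
Proof.
move=> [u uu eu] h.
case: (boolP [forall j, f ((A + A^T) 0 j) == 0]); last first.
  by rewrite negb_forall => /existsP[j /f_unit uj]; exists j.
move/forallP => f0; exfalso; have [n_odd|n_even] := boolP (odd n.+1).
  have {h} A0 : f (A 0 0) = 0 by case: h => //; rewrite n_odd.
  have [j|t t0] := det_even_odd n_odd A0.
    by have /eqP := f0 j; rewrite !mxE.
  rewrite eu n_odd expr1 => /(mulfI two_neq0) ut.
  by have := unit_f uu; rewrite ut t0 eqxx.
have : f (\det (A + A^T)) = 0.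
  rewrite -det_map_mx (expand_det_row _ 0) big1 // => j _.
  by rewrite mxE (eqP (f0 j)) mul0r.
rewrite eu (negPf n_even) expr0 mul1r => u0.
by have := unit_f uu; rewrite u0 eqxx.
Qed.

(** This is the smoothness of the reduced quadric at [v]: the gradient does not vanish there. Taking
    [v] as first basis vector reduces it to [exists_pairing_first]. *)
Lemma exists_pairing n (A : 'M[R]_n) v :
  semiregular (A + A^T) -> map_mx f v != 0 -> (f (qval A v) = 0 \/ ~~ odd n) ->
  exists w, bilin (A + A^T) v w \is a GRing.unit.
Proof.
case: n A v => [|n] A v rA /unit_coord[i ui]; first by case: i ui => [].
move=> h; have [M uM Mv] := exists_basis ui.
have [||j uj] := @exists_pairing_first _ (M^T *m A *m M).
- rewrite -even_congruent; apply: semiregular_congruent rA; by exists M.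
- case: h => [h|]; [left|by right].
  by rewrite -Mv -qval_congr -[qval _ _]/(bilin _ _ _) bilin_delta in h.
exists (M *m delta_mx j 0).
by rewrite -Mv -bilin_congr bilin_delta even_congruent.
Qed.

(** A smooth solution lifts: on the line [v + t *: w], with [w] pairing to a unit with [v], the
    equation is quadratic in [t] and [hensel2] solves it. *)
Lemma hensel_qval n (A : 'M[R]_n) v a :
  semiregular (A + A^T) -> map_mx f v != 0 -> f (qval A v) = f a ->
  (f a = 0 \/ ~~ odd n) -> exists2 v', map_mx f v' = map_mx f v & qval A v' = a.
Proof.
move=> rA v0 va h; have [|w uw] := exists_pairing rA v0; first by rewrite va.
have [|t t0 et] := @hensel2 (qval A v - a) (bilin (A + A^T) v w) (qval A w) _ uw.
  by rewrite rmorphB /= va subrr.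
exists (v + t *: w).
  by rewrite map_mxD map_mxZ t0 scale0r addr0.
by apply/eqP; rewrite qvalDZ -subr_eq0 -et; apply/eqP; ring.
Qed.

Lemma lift_mx m n (x : 'M[k]_(m, n)) : exists v, map_mx f v = x.
Proof.
have [g gK] := fin_all_exists (fun ij : 'I_m * 'I_n => f_surj (x ij.1 ij.2)).
by exists (\matrix_(i, j) g (i, j)); apply/matrixP => i j; rewrite !mxE gK.
Qed.

Lemma exists_isotropic n (A : 'M[R]_n) : (2 < n)%N -> semiregular (A + A^T) ->
  exists2 v, map_mx f v != 0 & qval A v = 0.
Proof.
move=> n2 rA; have [x x0 qx] := qform_isotropic (map_mx f A) n2.
have [v vx] := lift_mx x.
have [|||v' fv' qv'] := @hensel_qval _ A v 0 rA.
- by rewrite vx.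
- by rewrite rmorph0 map_qval vx.
- by left; rewrite rmorph0.
by exists v'; rewrite // fv' vx.
Qed.

(** Chevalley-Warning gives a zero [(x, z)] of the ternary form [q(x) - z ^+ 2] over [k]. If
    [z != 0], dividing by [z] gives the value 1. If [z = 0], then [x] is isotropic and the value 1
    is reached on a line in its direction. *)
Lemma exists_qval1 (A : 'M[R]_2) : semiregular (A + A^T) ->
  exists2 v, map_mx f v != 0 & qval A v = 1.
Proof.
move=> rA.
suff [v v1] : exists v, f (qval A v) = 1.
  have v0 : map_mx f v != 0.
    apply: contra_eq_neq v1 => v0.
    by rewrite map_qval v0 /qval mulmx0 mxE eq_sym oner_neq0.
  have [||v' fv' qv'] := @hensel_qval _ A v 1 rA v0; rewrite ?rmorph1 //.
    by right.
  by exists v'; rewrite ?fv'.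
pose B : 'M[k]_(2 + 1) := block_mx (map_mx f A) 0 0 (-1)%:M.
have [x x0 qx] := @qform_isotropic _ _ B isT.
have {qx} qx : qval (map_mx f A) (usubmx x) = (dsubmx x 0 0) ^+ 2.
  move: qx; rewrite /qval -[in LHS](vsubmxK x) tr_col_mx mul_row_block.
  rewrite !mulmx0 addr0 add0r mul_row_col [_ 0 0]mxE => /eqP.
  rewrite addr_eq0 => /eqP ->; rewrite mul_mx_scalar -scalemxAl scaleN1r.
  by rewrite !mxE opprK big_ord1 !mxE expr2.
have [z0|z0] := eqVneq (dsubmx x 0 0) 0; last first.
  have [v vx] := lift_mx ((dsubmx x 0 0)^-1 *: usubmx x).
  by exists v; rewrite map_qval vx qvalZ qx exprVn mulVf ?expf_neq0.
have [v vx] := lift_mx (usubmx x).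
have qv : f (qval A v) = 0 by rewrite map_qval vx qx z0 expr0n.
have v0 : map_mx f v != 0.
  rewrite vx; apply: contraNneq x0 => u0; rewrite -(vsubmxK x) u0.
  by rewrite [dsubmx x]mx11_scalar z0 raddf0 col_mx0.
have [|w uw] := exists_pairing rA v0; first by left.
(* This [s] makes the terms of degree at most one in [qvalDZ] add up to 1; the quadratic term is
   killed by [f], as [qval A v] is. *)
pose s := (1 - qval A w) / bilin (A + A^T) v w.
exists (w + s *: v); rewrite qvalDZ.
have bC : bilin (A + A^T) w v = bilin (A + A^T) v w.
  have sA : (A + A^T)^T = A + A^T by rewrite linearD /= trmxK addrC.
  rewrite /bilin (_ : w^T *m _ *m v = (v^T *m (A + A^T) *m w)^T).
    by rewrite mxE.
  by rewrite !trmx_mul trmxK sA mulmxA.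
rewrite bC /s mulrCA divrr // mulr1.
by rewrite [_ + (1 - _)]addrCA subrr addr0 rmorphD rmorph1 rmorphM /= qv mul0r addr0.
Qed.

(* The Hessian matrix of the form x y. *)
Definition hyperbolic : 'M[R]_2 := mx22 0 1 1 0.

Lemma det_hyperbolic : \det hyperbolic = -1.
Proof. by rewrite det_mx22 mul0r sub0r mulr1. Qed.

Lemma congruent_hyperbolic b c : b \is a GRing.unit ->
  congruent (mx22 0 b b (2%:R * c)) hyperbolic.
Proof.
move=> ub; exists (mx22 1 (- c / b ^+ 2) 0 b^-1).
  by rewrite unitmxE det_mx22 mulr0 subr0 mul1r unitrV.
have bb : b / b = 1 by rewrite divrr.
rewrite tr_mx22 !mul_mx22 /hyperbolic -exprVn; congr mx22; ring: bb.
Qed.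

Lemma congruent_first n (A : 'M[R]_n.+1) v : map_mx f v != 0 ->
  exists2 B, congruent (A + A^T) (B + B^T) & B 0 0 = qval A v.
Proof.
move=> /unit_coord[i ui]; have [M uM <-] := exists_basis ui.
exists (M^T *m A *m M); first by exists M; rewrite // even_congruent.
by rewrite -qval_congr -[qval _ _]/(bilin _ _ _) bilin_delta.
Qed.

Lemma det_split n (H1 : 'M[R]_n.+1) :
  \det (block_mx hyperbolic 0 0 H1 : 'M_n.+3) = - \det H1.
Proof.
exact: etrans (det_ublock _ _ _)
  (etrans (congr1 ( *%R^~ _) det_hyperbolic) (mulN1r _)).
Qed.

(** An isotropic first basis vector pairs to a unit with some basis vector [j]. The two span a plane
    with invertible Gram matrix, which is hyperbolic and splits off by a Schur complement. *)
Lemma split_hyperbolic n (H : 'M[R]_n.+3) : even_mx H -> semiregular H ->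
  exists H1 : 'M[R]_n.+1, [/\ even_mx H1, semiregular H1 &
    congruent H (block_mx hyperbolic 0 0 H1 : 'M[R]_(2 + n.+1))].
Proof.
move=> [A ->] rA; have [v v0 qv] := @exists_isotropic n.+3 A isT rA.
have [B cAB B00] := congruent_first A v0.
have rB := semiregular_congruent cAB rA.
have [|j uj] := exists_pairing_first rB; first by left; rewrite B00 qv rmorph0.
have H00 : (B + B^T) 0 0 = 0 by rewrite !mxE B00 qv addr0.
have j0 : j != 0 by apply: contraTneq uj => ->; rewrite H00 unitr0.
set H' := (B + B^T) in cAB rB uj H00; clearbody H'.
(* The partner [j] is moved to index 1; index 0 stays in place because [j != 0]. *)
pose H2 : 'M[R]_(2 + n.+1) := row_perm (tperm 1 j) (col_perm (tperm 1 j) H').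
have cH2 : congruent (A + A^T) H2 := congruent_trans cAB (congruent_perm _ _).
have [B2 eH2] : even_mx H2 by apply: (congruent_even cH2); exists A.
have t0 : tperm 1 j 0 = 0 by rewrite tpermD // eq_sym.
pose U := ulsubmx H2; pose C := ursubmx H2; pose D := drsubmx H2.
have sH2 : H2^T = H2 by rewrite eH2 linearD /= trmxK addrC.
have sU : U^T = U by rewrite /U trmx_ulsub sH2.
have eC : dlsubmx H2 = C^T by rewrite /C trmx_ursub sH2.
pose c := B2 1 1.
have UE a b : U a b = H' (tperm 1 j (lshift n.+1 a)) (tperm 1 j (lshift n.+1 b)).
  by rewrite !mxE.
have l0 : lshift n.+1 (0 : 'I_2) = 0 by apply: val_inj.
have l1 : lshift n.+1 (1 : 'I_2) = 1 by apply: val_inj.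
have U01 : U 0 1 = H' 0 j by rewrite UE l0 l1 t0 tpermL.
have eU : U = mx22 0 (H' 0 j) (H' 0 j) (2%:R * c).
  apply: matrix2P; rewrite [RHS]mxE //=.
  - by rewrite UE l0 t0 H00.
  - by rewrite -sU mxE U01.
  - by rewrite /U eH2 /c mxE mxE l1 !mxE mulr_natl.
have uU : U \in unitmx.
  by rewrite unitmxE eU det_mx22 mul0r sub0r unitrN unitrM uj.
have cH2' := congruent_schur C D sU uU.
rewrite -{1}eC submxK in cH2'.
have cH : congruent (A + A^T) (block_mx hyperbolic 0 0 (D - C^T *m invmx U *m C)).
  apply: congruent_trans (congruent_trans cH2 cH2') _.
  apply: (@congruent_block _ 2 n.+1); last exact: congruent_refl.
  by rewrite eU; apply: congruent_hyperbolic.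
exists (D - C^T *m invmx U *m C); split=> //.
  (* Evenness passes to the complement, a diagonal block of an even matrix. *)
  have [|B3 eB3] := @congruent_even R (2 + n.+1) _ _ cH; first by exists A.
  exists (drsubmx B3); move/(congr1 drsubmx): eB3.
  rewrite block_mxKdr => ->; apply/matrixP => a b; by rewrite !mxE.
(* The plane has determinant -1 and even rank, so the half-determinant only changes by a unit square
   and a sign. *)
have [u uu] := semiregular_congruent cH rA.
rewrite det_split => e.
by exists (- u); rewrite ?unitrN // mulrN; apply: oppr_inj; rewrite opprK e /= !negbK.
Qed.

Lemma binary_normal_form (H : 'M[R]_2) : even_mx H -> semiregular H ->
  exists b c, congruent H (mx22 2%:R b b (2%:R * c)).
Proof.
move=> [A ->] rA; have [v v0 qv] := exists_qval1 rA.
have [B cAB B00] := congruent_first A v0.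
exists ((B + B^T) 0 1), (B 1 1).
suff -> : mx22 2%:R ((B + B^T) 0 1) ((B + B^T) 0 1) (2%:R * B 1 1) = B + B^T by [].
by apply: matrix2P; rewrite !mxE /= ?B00 ?qv ?mulr_natl // addrC.
Qed.

(** Both forms become [x^2 + b x y + c y^2], with discriminants [b^2 - 4 c] that differ by the
    square of a unit [w]. The substitution [x -> x + s y], [y -> w y] then carries one to the
    other. *)
Lemma congruent_binary (H H' : 'M[R]_2) u :
  even_mx H -> even_mx H' -> semiregular H -> u \is a GRing.unit ->
  \det H' = \det H * u ^+ 2 -> congruent H H'.
Proof.
move=> eH eH' rH uu dH'.
have rH' := semiregular_sq uu dH' rH.
have [b [c cH]] := binary_normal_form eH rH.
have [b' [c' cH']] := binary_normal_form eH' rH'.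
apply: (congruent_trans cH).
suff : congruent (mx22 2%:R b b (2%:R * c)) (mx22 2%:R b' b' (2%:R * c')).
  by move=> h; apply: congruent_trans h (congruent_sym cH').
have [m um dm] := congruent_det cH; have [m' um' dm'] := congruent_det cH'.
pose w := u * m' / m.
have uw : w \is a GRing.unit by rewrite !unitrM uu um' unitrV.
have dw : \det (mx22 2%:R b' b' (2%:R * c')) = \det (mx22 2%:R b b (2%:R * c)) * w ^+ 2.
  rewrite dm' dH' dm /w !exprMn.
  have mm : m / m = 1 by rewrite divrr.
  by ring: mm.
rewrite !det_mx22 in dw.
have e4 : 2%:R * (2%:R * c') = (2%:R * (2%:R * c) - b * b) * w ^+ 2 + b' * b'.
  by rewrite -dw subrK.
have [s es] : exists s, b' - b * w = 2%:R * s.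
  (* Equality of the discriminants after scaling by [w ^+ 2] says that [s = (b' - b w) / 2]
     satisfies [s^2 + b w s = c' - c w^2]. *)
  apply: (@half_closed _ (b * w) (c' - c * w ^+ 2)).
  have -> : 4%:R * (c' - c * w ^+ 2) = 2%:R * (2%:R * c') - 4%:R * c * w ^+ 2 by ring.
  by rewrite e4; ring.
exists (mx22 1 s 0 w); first by rewrite unitmxE det_mx22 mulr0 subr0 mul1r.
have eb' : b' = b * w + 2%:R * s by rewrite -es addrC subrK.
have ec' : c' = c * w ^+ 2 + s * b * w + s ^+ 2.
  apply: (mulfI two_neq0); apply: (mulfI two_neq0).
  by rewrite e4 eb'; ring.
by rewrite tr_mx22 !mul_mx22 ec' eb'; congr mx22; ring.
Qed.

(** Induction in steps of two: hyperbolic planes are split off both forms, and the determinants of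
    the complements still differ by a unit square. Ranks 0, 1 and 2 are the base cases. *)
Lemma semiregular_classification n (H H' : 'M[R]_n) u :
  even_mx H -> even_mx H' -> semiregular H -> u \is a GRing.unit ->
  \det H' = \det H * u ^+ 2 -> congruent H H'.
Proof.
elim/ltn_ind: n H H' u => -[|[|[|n]]] IH H H' u eH eH' rH uu dH'.
- by exists 1%:M; rewrite ?unitmx1 // [LHS]flatmx0 [RHS]flatmx0.
- exists u%:M; first by rewrite unitmxE det_scalar1.
  rewrite tr_scalar_mx mul_scalar_mx mul_mx_scalar scalerA -expr2.
  rewrite [H']mx11_scalar [H]mx11_scalar -det_mx11 dH' det_mx11 mulrC.
  by rewrite scale_scalar_mx.
- exact: (@congruent_binary _ _ u).
have rH' := semiregular_sq uu dH' rH.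
have [H1 [eH1 rH1 cH]] := split_hyperbolic eH rH.
have [H1' [eH1' rH1' cH']] := split_hyperbolic eH' rH'.
apply: (congruent_trans cH).
apply: congruent_trans _ (congruent_sym cH').
apply: (@congruent_block _ 2 n.+1); first exact: congruent_refl.
have [m um dm] := congruent_det cH; have [m' um' dm'] := congruent_det cH'.
apply: (@IH n.+1 _ _ _ (u * m' / m)) => //; first by rewrite !unitrM uu um' unitrV.
move: dm dm'; rewrite !det_split dH' => dm dm'.
apply: oppr_inj; rewrite dm' -mulNr dm !exprMn.
have mm : m / m = 1 by rewrite divrr.
by ring: mm.
Qed.
End Henselian.

(** * The valuation ring and its residue field *)

(* A copy of a field [k] that carries a finite type structure read off from the
   proof that [s] enumerates [k]. *)
Definition enumerated (k : fieldType) (s : seq k) (us : uniq s)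
  (hs : forall x, x \in s) : Type := k.

Section Enumerated.
Variables (k : fieldType) (s : seq k) (us : uniq s) (hs : forall x, x \in s).
Local Notation T := (enumerated us hs).
HB.instance Definition _ := GRing.Field.on T.

Lemma index_nthK :
  pcancel (fun x : T => index (x : k) s) (fun i => Some (nth 0%R s i : T)).
Proof. by move=> x; rewrite nth_index. Qed.
HB.instance Definition _ := Choice_isCountable.Build T index_nthK.

Lemma enumeratedP : Finite.axiom (s : seq T).
Proof. by move=> x; rewrite count_uniq_mem // hs. Qed.
HB.instance Definition _ := isFinite.Build T enumeratedP.
End Enumerated.

(** A list without repetition consists of roots of [G], which bounds its length; one of maximal
    length contains every element. *)
Lemma enum_of_roots (k : idomainType) (G : {poly k}) :
  G != 0 -> (forall x, root G x) -> exists2 s : seq k, uniq s & forall x, x \in s.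
Proof.
move=> G0 rG; pose U n := `[< exists2 s : seq k, uniq s & size s = n >].
have U0 : exists n, U n by exists 0%N; apply/asboolP; exists [::].
have Ub n : U n -> (n <= size G)%N.
  move=> /asboolP[s us <-]; apply/ltnW/max_poly_roots => //.
  by apply/allP => x _.
case: (ex_maxnP U0 Ub) => n /asboolP[s us sn] mx; exists s => // x.
apply: contraT => xs; suff : (n.+1 <= n)%N by rewrite ltnn.
by apply: mx; apply/asboolP; exists (x :: s); rewrite /= ?xs ?us ?sn.
Qed.

Section ValuationRing.
Variables (F : fieldExtType rat) (P : prime_idealr (ring_of_integers F)).
Variable K : completion P.

Definition Op_pred : {pred K} := fun x => `[< Op x >].

Lemma OpP x : reflect (Op x) (x \in Op_pred).
Proof. exact: asboolP. Qed.

Lemma OpN (x : K) : Op x -> Op (- x).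
Proof. by rewrite -mulN1r; apply: OpM (@OpN1 _ _ K). Qed.

Fact Op_subring : subring_closed Op_pred.
Proof.
split=> [|x y /OpP hx /OpP hy|x y /OpP hx /OpP hy]; apply/OpP.
- exact: Op1.
- by apply: OpD => //; apply: OpN.
- exact: OpM.
Qed.
HB.instance Definition _ := GRing.isSubringClosed.Build K Op_pred Op_subring.

Record valuation_ring := ValuationRing { vr_val :> K; _ : vr_val \in Op_pred }.
HB.instance Definition _ := [isSub for vr_val].
HB.instance Definition _ := [Choice of valuation_ring by <:].
HB.instance Definition _ := [SubChoice_isSubComNzRing of valuation_ring by <:].

Lemma vr_Op (x : valuation_ring) : Op (vr_val x).
Proof. by case: x => x /= /OpP. Qed.

Definition vr_unit : {pred valuation_ring} :=
  fun x => (vr_val x != 0) && ((vr_val x)^-1 \in Op_pred).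
Definition vr_inv (x : valuation_ring) : valuation_ring :=
  if vr_unit x then insubd x (vr_val x)^-1 else x.

Fact vr_mulVx : {in vr_unit, left_inverse 1 vr_inv *%R}.
Proof.
move=> x ux; have /andP[x0 Vx] := (ux : vr_unit x).
apply: val_inj; rewrite /= /vr_inv (ux : vr_unit x) -[vr_val (insubd _ _)]/(val _).
by rewrite val_insubd Vx mulVf.
Qed.

Fact vr_unitPl (x y : valuation_ring) : y * x = 1 -> vr_unit x.
Proof.
move=> /(congr1 val) /= yx; have x0 : vr_val x != 0.
  by apply: contra_eq_neq yx => ->; rewrite mulr0 eq_sym oner_neq0.
rewrite /vr_unit x0 /= (_ : (vr_val x)^-1 = vr_val y); first exact: (valP y).
by apply: (mulIf x0); rewrite mulVf.
Qed.

Fact vr_invr_out : {in [predC vr_unit], vr_inv =1 id}.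
Proof.
move=> x; rewrite inE /= /vr_inv => /negPf h.
by rewrite -topredE /= in h; rewrite h.
Qed.

HB.instance Definition _ := GRing.ComNzRing_hasMulInverse.Build valuation_ring
  vr_mulVx vr_unitPl vr_invr_out.

Fact vr_integral : GRing.integral_domain_axiom valuation_ring.
Proof.
move=> x y /(congr1 val)/eqP; rewrite /= mulf_eq0.
by rewrite -!(inj_eq val_inj).
Qed.
HB.instance Definition _ :=
  GRing.ComUnitRing_isIntegral.Build valuation_ring vr_integral.

Definition max_pred : valuation_ring -> bool :=
  fun x => `[< val_ge (@ord F P K) 1 (vr_val x) >].
Arguments max_pred : clear implicits.

Lemma maxP x : reflect (val_ge (@ord F P K) 1 (vr_val x)) (x \in max_pred).
Proof. exact: asboolP. Qed.

Fact max_idealr : idealr_closed max_pred.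
Proof.
split=> [||a x y /maxP hx /maxP hy].
- by apply/maxP; rewrite /val_ge eqxx.
- by apply/maxP => /(_ (oner_neq0 _)); rewrite ord_one.
- by apply/maxP; apply: ordD => //; apply: (@val_geM _ _ _ 0 1) => //; apply: vr_Op.
Qed.
HB.instance Definition _ := isIdealr.Build valuation_ring max_pred max_idealr.
Definition max_ideal : idealr valuation_ring := max_pred.

Lemma ordV (x : K) : x != 0 -> ord x^-1 = - ord x.
Proof.
move=> x0; apply/eqP; rewrite -addr_eq0 -ordM ?invr_eq0 // mulVf //.
by rewrite ord_one.
Qed.

Lemma vr_unitE (x : valuation_ring) :
  (x \is a GRing.unit) = (vr_val x != 0) && (ord (vr_val x) == 0).
Proof.
rewrite -[LHS]/(vr_unit x) /vr_unit; case: (eqVneq (vr_val x) 0) => //= x0.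
have := @vr_Op x x0; case: OpP => [/(_ (invr_neq0 x0))|]; rewrite ?ordV //.
  by move=> h1 h2; symmetry; apply/eqP; lia.
move=> h _; symmetry; apply/eqP => e; apply: h => _.
by rewrite ordV // e.
Qed.

Lemma max_unit (x : valuation_ring) :
  (x \in max_pred) = (x \isn't a GRing.unit).
Proof.
rewrite vr_unitE; case: (eqVneq (vr_val x) 0) => /= x0.
  by apply/maxP; rewrite /val_ge x0 eqxx.
have := @vr_Op x x0; case: maxP => [/(_ x0)|h h0]; first by lia.
symmetry; apply/negPn/eqP.
have : ~ (1 <= ord (vr_val x)) by move=> h1; apply: h.
by lia.
Qed.

Definition residue_field := {ideal_quot max_ideal}.
HB.instance Definition _ := GRing.ComNzRing.on residue_field.

Definition residue (x : valuation_ring) : residue_field :=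
  (\pi_{ideal_quot max_ideal} x)%qT.
HB.instance Definition _ := GRing.RMorphism.copy residue
  (\pi_{ideal_quot max_ideal} : valuation_ring -> residue_field)%qT.

Lemma residue_eq0 (x : valuation_ring) :
  (residue x == 0) = (x \isn't a GRing.unit).
Proof.
rewrite -max_unit -[x in RHS]subr0 Quotient.idealrBE.
by congr (_ == _); rewrite rmorph0.
Qed.

Lemma residue_surj y : exists x, residue x = y.
Proof. by exists (repr y); apply: reprK. Qed.

Definition residue_inv (y : residue_field) : residue_field :=
  if y == 0 then 0 else residue (repr y)^-1.

Fact residue_mulVf y : y != 0 -> residue_inv y * y = 1.
Proof.
move=> y0; rewrite /residue_inv (negPf y0).
have e : residue (repr y) = y by apply: reprK.
by rewrite -{2}e -rmorphM mulVr ?rmorph1 // -[_ \is a _]negbK -residue_eq0 e.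
Qed.

Fact residue_inv0 : residue_inv 0 = 0.
Proof. by rewrite /residue_inv eqxx. Qed.

HB.instance Definition _ :=
  GRing.ComNzRing_isField.Build residue_field residue_mulVf residue_inv0.

Lemma natrS_neq0 n : (n.+1%:R : K) != 0.
Proof.
rewrite -(rmorph_nat (completion_emb K)) fmorph_eq0.
by rewrite -(rmorph_nat (GRing.in_alg F)) fmorph_eq0 pnatr_eq0.
Qed.

(** * Finiteness of the residue field *)

Lemma emb_intr (K' : nzRingType) (g : {rmorphism F -> K'}) (q : {poly int}) (a : F) :
  root (map_poly intr q) a -> root (map_poly intr q) (g a).
Proof.
move=> /rootP qa; apply/rootP; rewrite -(rmorph0 g) -qa -horner_map -map_poly_comp.
by congr _.[_]; apply: eq_map_poly => z /=; rewrite rmorph_int.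
Qed.

Lemma vr_root_intr (q : {poly int}) (A : valuation_ring) :
  root (map_poly intr q) (vr_val A) -> root (map_poly intr q) A.
Proof.
move=> /rootP qA; apply/rootP/val_inj; rewrite -[LHS]horner_map -map_poly_comp.
rewrite -[RHS]/0 -[RHS]qA.
congr _.[_]; apply: eq_map_poly => z.
exact: (rmorph_int (val : valuation_ring -> K)).
Qed.

(** A nonzero element of [P] is a root of an integer polynomial with nonzero constant term. That
    constant is a multiple of the element, so it vanishes in the residue field. *)
Lemma residue_pchar : (exists2 x, x \in P & x != 0) ->
  exists p, p \in [pchar residue_field].
Proof.
move=> [x xP x0]; have y0 : completion_emb K (val x) != 0.
  by rewrite fmorph_eq0.
have oy : 1 <= ord (completion_emb K (val x)).
  (* The first power of [P] unfolds to the product of [P] with the unit ideal, and [x] is the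
     one-term sum [1 * (x * 1)] in it. *)
  apply/(ord_emb _ _ x0); exists 1%N, (fun=> 1), (fun=> x); split.
    by move=> _; split=> //; exists x => //; exists 1; rewrite ?mulr1.
  by rewrite big_ord1 mul1r.
have [A eA] : exists A : valuation_ring, vr_val A = completion_emb K (val x).
  have h : completion_emb K (val x) \in Op_pred.
    by apply/OpP => _; apply: le_trans oy.
  by exists (ValuationRing h).
have A0 : A != 0 by rewrite -(inj_eq val_inj) /= eA.
have [q q_monic qx] : integralOver (intr : int -> F) (val x).
  by have := valP x; rewrite unfold_in => /asboolP.
have {qx} qA : root (map_poly intr q) A.
  by apply: vr_root_intr; rewrite eA; apply: emb_intr.
(* Dividing out the powers of ['X] makes the constant term nonzero; [A] remains a root because it is
   nonzero. *)
have [m [q1 /implyP/(_ (monic_neq0 q_monic)) q10 eq1]] := multiplicity_XsubC q 0.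
have {qA} q1A : root (map_poly intr q1) A.
  move: qA; rewrite eq1 rmorphM rmorphXn rmorphB /= map_polyX map_polyC /= rootM.
  case/orP=> //; rewrite /root horner_exp expf_eq0 => /andP[_].
  by rewrite !hornerE rmorph0 subr0 (negPf A0).
have /factor_theorem[q2 eq2] : root (q1 - (q1.[0])%:P) 0.
  by rewrite /root !hornerE subrr.
have c0 : residue (q1.[0])%:~R = 0.
  have e : (q1.[0])%:~R = - ((map_poly intr q2).[A] * A).
    apply/eqP; rewrite -addr_eq0 addrC; apply/eqP; move/rootP: q1A => <-.
    rewrite -[in RHS](subrK (q1.[0])%:P q1) eq2 rmorphD rmorphM rmorphB /=.
    by rewrite map_polyX !map_polyC /= !hornerE rmorph0 subr0.
  rewrite e rmorphN rmorphM /= (_ : residue A = 0) ?mulr0 ?oppr0 //.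
  by apply/eqP; rewrite residue_eq0 -max_unit; apply/maxP => _; rewrite eA.
apply: (@natf0_pchar _ `|q1.[0]|%N); first by rewrite absz_gt0.
move/eqP: c0; rewrite rmorph_int; case: (intP q1.[0]) => [|z|z] //.
by rewrite rmorphN /= oppr_eq0.
Qed.

(* The element [y] is the residue of some [a] in [F], by density; the minimal
   polynomial of [a] over the rationals, made primitive over the integers, does
   not vanish modulo [p]. *)
Lemma residue_root p (y : residue_field) : p \in [pchar residue_field] ->
  exists2 c : {ffun 'I_(\dim {:F}).+1 -> 'I_p},
    \poly_(i < (\dim {:F}).+1) (c (inord i))%:R != 0 :> {poly residue_field} &
    root (\poly_(i < (\dim {:F}).+1) (c (inord i))%:R) y.
Proof.
move=> pc; have p_pr := pcharf_prime pc.
have [r ry] := residue_surj y.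
have [a ha] := completion_dense (vr_val r) 1.
have [A eA] : exists A : valuation_ring, vr_val A = completion_emb K a.
  have h : completion_emb K a \in Op_pred.
    rewrite -[completion_emb K a](subKr (vr_val r)); apply: rpredB (valP r) _.
    by apply/OpP => /ha; apply: le_trans.
  by exists (ValuationRing h).
have {r ry ha} Ay : residue A = y.
  rewrite -ry; apply/eqP; rewrite eq_sym -subr_eq0 -rmorphB residue_eq0 -max_unit.
  by apply/maxP; rewrite /= eA.
have /polyOver1P[q eq] := minPolyOver 1 a.
have sq : (size q <= (\dim {:F}).+1)%N.
  rewrite -(size_map_poly (GRing.in_alg F)) -eq size_minPoly ltnS.
  rewrite adjoin_degreeE dimv1 divn1; apply: dimvS; exact: subvf.
have q0 : q != 0.
  by rewrite -(map_poly_eq0 (GRing.in_alg F)) -eq monic_neq0 ?monic_minPoly.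
have [z [b b0 ez]] := rat_poly_scale q.
pose w := zprimitive z.
have z0 : z != 0 by apply: contraNneq q0 => z0; rewrite ez z0 rmorph0 scaler0.
have sw : (size w <= (\dim {:F}).+1)%N.
  apply: leq_trans sq; rewrite ez size_scale ?invr_eq0 ?intr_eq0 //.
  by rewrite size_zprimitive (size_map_inj_poly (@intr_inj rat)).
have wA : root (map_poly intr w) A.
  apply: vr_root_intr; rewrite eA; apply: emb_intr.
  have e : minPoly 1 a =
      GRing.in_alg F b%:~R^-1 *: ((zcontents z)%:~R *: map_poly intr w).
    rewrite eq ez map_polyZ; congr (_ *: _).
    rewrite -map_poly_comp -(map_polyZ intr) -zpolyEprim.
    by apply: eq_map_poly => t; exact: (rmorph_int (GRing.in_alg F)).
  have := root_minPoly 1 a; rewrite e !rootZ //.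
    by rewrite -(rmorph_int (GRing.in_alg F)) fmorph_eq0 intr_eq0 zcontents_eq0.
  by rewrite fmorph_eq0 invr_eq0 intr_eq0.
have wy : root (map_poly intr w) y.
  have := congr1 residue (rootP wA); rewrite -horner_map -map_poly_comp rmorph0 -Ay.
  move=> /rootP; congr (is_true (root _ _)).
  by apply: eq_map_poly => t /=; rewrite rmorph_int.
have p0 : (p : int) != 0 by rewrite -lt0n prime_gt0.
have cP i : (`|(w`_i %% p)%Z| < p)%N.
  by rewrite -ltz_nat gez0_abs ?modz_ge0 // ltz_pmod // ltz_nat prime_gt0.
pose c := [ffun i : 'I_(\dim {:F}).+1 => Ordinal (cP i)].
have cE i : (`|(w`_i %% p)%Z|%:R : residue_field) = (w`_i)%:~R.
  rewrite pmulrn gez0_abs ?modz_ge0 // {2}(divz_eq w`_i p) [in RHS]intrD intrM.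
  by rewrite -pmulrn (pcharf0 pc) mulr0 add0r.
have ew : \poly_(i < (\dim {:F}).+1) (c (inord i))%:R = map_poly intr w
    :> {poly residue_field}.
  apply/polyP => i; rewrite coef_poly coef_map /=; case: ltnP => hi.
    by rewrite ffunE /= inordK // cE.
  by rewrite nth_default ?rmorph0 // (leq_trans sw).
exists c; rewrite ew //.
(* If the reduction were zero, [p] would divide the content of the primitive polynomial [w], which
   is 1. *)
apply/eqP => /polyP h.
have : zcontents w = 1 by rewrite zcontents_primitive z0.
have : (p%:Z %| zcontents w)%Z.
  rewrite dvdz_contents; apply/polyOverP => i; apply/dvdz_mod0P/eqP.
  have := h i; rewrite coef_map coef0 /= -cE => /eqP.
  rewrite -(dvdn_pcharf pc) -absz_eq0.
  by case: posnP => [->|n0] //; rewrite gtnNdvd.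
by move=> + e; rewrite e dvdz1 /= => /eqP p1; rewrite p1 in p_pr.
Qed.

(** Only finitely many polynomials occur in [residue_root]; the product of the nonzero ones vanishes
    at every element. *)
Lemma residue_finite : (exists2 x, x \in P & x != 0) ->
  exists2 s : seq residue_field, uniq s & forall y, y \in s.
Proof.
move=> /residue_pchar[p pc].
pose g (c : {ffun 'I_(\dim {:F}).+1 -> 'I_p}) : {poly residue_field} :=
  \poly_(i < (\dim {:F}).+1) (c (inord i))%:R.
apply: (@enum_of_roots _ (\prod_(c | g c != 0) g c)).
  by apply/prodf_neq0.
move=> y; have [c c0 cy] := residue_root y pc.
by rewrite (bigD1 c) //= rootM cy.
Qed.

(* [t] is the limit of the iterates of [t |-> - (a + c * t ^+ 2) / b], which
   contracts the maximal ideal. *)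
Lemma vr_hensel2 (a b c : valuation_ring) :
  a \isn't a GRing.unit -> b \is a GRing.unit ->
  exists2 t, t \isn't a GRing.unit & a + b * t + c * t ^+ 2 = 0.
Proof.
move=> ua ub.
pose g t := - (a + c * t ^+ 2) / b.
have I0 : 0 \in max_pred by apply: idealr0.
have gI t : t \in max_pred -> g t \in max_pred.
  move=> tI; rewrite /g mulrC idealMr // rpredN rpredD ?max_unit //.
  by rewrite -max_unit expr2 mulrA idealMr.
pose u n := iter n g 0.
have uI n : u n \in max_pred by elim: n => //= n /gI.
have ge_mul (N N' : int) (x y : valuation_ring) :
    val_ge (@ord F P K) N (vr_val x) -> val_ge (@ord F P K) N' (vr_val y) ->
    val_ge (@ord F P K) (N + N') (vr_val (x * y)).
  exact: val_geM.
(* In [u n.+2 - u n.+1] the factor [u n.+1 + u n] lies in the maximal ideal, which gains one order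
   at each iteration. *)
have step n : val_ge (@ord F P K) n%:Z (vr_val (u n.+1 - u n)).
  elim: n => [|n IH]; first exact: (@vr_Op (u 1 - u 0)).
  have -> : u n.+2 - u n.+1 = - (c / b) * ((u n.+1 + u n) * (u n.+1 - u n)).
    rewrite /u !iterS -/(u n) /g; ring.
  rewrite -[n.+1%:Z]add0r; apply: (ge_mul); first exact: vr_Op.
  rewrite -[n.+1]add1n PoszD; apply: (ge_mul) => //.
  by apply/maxP; rewrite rpredD.
have cauchy n m : (n <= m)%N -> val_ge (@ord F P K) n%:Z (vr_val (u m - u n)).
  move=> /subnK <-; elim: (m - n)%N => [|d IH]; first by rewrite subrr /val_ge eqxx.
  have -> : u (d.+1 + n)%N - u n = (u (d + n).+1 - u (d + n)%N) + (u (d + n)%N - u n).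
    by rewrite addrA subrK.
  apply: ordD => //; move=> h; apply: le_trans (step _ h).
  by rewrite lez_nat leq_addl.
have [l hl] : exists l : K, forall N : int, exists m0 : nat, forall i : nat,
      (m0 <= i)%N -> val_ge (@ord F P K) N (vr_val (u i) - l).
  apply: completion_complete => N; exists `|N|%N => i j hi hj.
  have hN m n : (`|N| <= n)%N -> (n <= m)%N ->
      val_ge (@ord F P K) N (vr_val (u m - u n)).
    by move=> hn hm h; apply: le_trans (cauchy _ _ hm h); lia.
  case: (leqP j i) => hij; first exact: hN.
  rewrite -opprB -mulN1r -[N]add0r; apply: val_geM; first exact: OpN1.
  by apply: hN => //; apply: ltnW.
have lI N : exists n, (n >= N)%N /\ val_ge (@ord F P K) N%:Z (vr_val (u n) - l).
  have [m0 h] := hl N%:Z; exists (maxn m0 N); split; first exact: leq_maxr.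
  by apply: h; exact: leq_maxl.
have lOp : l \in Op_pred.
  have [n [_ hn]] := lI 0%N; rewrite -[l](subKr (vr_val (u n))).
  by apply: rpredB; [exact: (valP (u n)) | apply/OpP].
pose t := ValuationRing lOp.
have t_lim N : exists n, (n >= N)%N /\ val_ge (@ord F P K) N%:Z (vr_val (u n - t)).
  exact: lI.
have tI : t \in max_pred.
  have [n [_ hn]] := t_lim 1%N; rewrite -[t](subKr (u n)) rpredB //.
  exact/maxP.
exists t; first by rewrite -max_unit.
apply: contrapT => /eqP nz.
pose e := a + b * t + c * t ^+ 2.
(* The value [e] at the limit is a combination of [u n.+1 - u n] and [u n - t], so its order exceeds
   every bound, which is impossible for a nonzero element. *)
have large N : val_ge (@ord F P K) N%:Z (vr_val e).
  have [n [hn hnt]] := t_lim N.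
  have -> : e = - b * (u n.+1 - u n) + (- b - c * (u n + t)) * (u n - t).
    rewrite /u iterS -/(u n) /g /e; have bb : b / b = 1 by rewrite divrr.
    ring: bb.
  rewrite -[N%:Z]add0r; apply: ordD; apply: (ge_mul) => //; try exact: vr_Op.
  by move=> h; apply: le_trans (step _ h); rewrite lez_nat.
have e0 : vr_val e != 0 by rewrite -(inj_eq val_inj) in nz.
have h0 := @vr_Op e e0; have := large `|ord (vr_val e)|.+1%N e0; lia.
Qed.

(** If [ord x < ord 2], then [x + 2 y] has order at most [ord x], for otherwise [x] itself would
    have larger order. Hence [x (x + 2 y)] has order less than that of 4 and cannot equal [4 z]. *)
Lemma vr_half_closed (x y z : valuation_ring) :
  x ^+ 2 + 2%:R * x * y = 4%:R * z -> exists s, x = 2%:R * s.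
Proof.
move=> e; have two0 : (2%:R : K) != 0 by exact: natrS_neq0.
have [x0|x0] := eqVneq (vr_val x) 0.
  by exists 0; apply: val_inj; rewrite mulr0.
suff h : vr_val x / 2%:R \in Op_pred.
  by exists (ValuationRing h); apply: val_inj; rewrite /= mulrCA mulfV ?mulr1.
apply/OpP => _; rewrite ordM ?invr_neq0 // ordV // subr_ge0.
case: (lerP (ord (2%:R : K)) (ord (vr_val x))) => [//|lt2].
exfalso; pose x2 := vr_val x + 2%:R * vr_val y.
have ex : vr_val x * x2 = 2%:R * 2%:R * vr_val z.
  move/(congr1 (val : valuation_ring -> K)): e.
  rewrite !(rmorphD, rmorphM, rmorphXn, rmorph_nat) /= => e.
  have -> : vr_val x * x2 = vr_val x ^+ 2 + 2%:R * vr_val x * vr_val y.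
    by rewrite /x2; ring.
  by rewrite e -natrM.
have v2y : val_ge (@ord F P K) (ord (vr_val x) + 1) (2%:R * vr_val y).
  rewrite mulrC -[_ + 1]add0r; apply: val_geM; first exact: vr_Op.
  by move=> _; lia.
have [x20 ox2] : x2 != 0 /\ ord x2 <= ord (vr_val x).
  suff : ~ val_ge (@ord F P K) (ord (vr_val x) + 1) x2.
    by move=> /not_implyP[x20 /negP]; rewrite -ltNge ltzD1.
  move=> h; have : val_ge (@ord F P K) (ord (vr_val x) + 1) (vr_val x).
    rewrite -[X in val_ge _ _ X](addrK (2%:R * vr_val y)); apply: ordD => //.
    by rewrite -mulN1r -[_ + 1]add0r; apply: val_geM; first exact: OpN1.
  by move=> /(_ x0); lia.
have z0 : vr_val z != 0.
  by apply: contraNneq (mulf_neq0 x0 x20) => z0; rewrite ex z0 mulr0.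
have /(congr1 (@ord F P K)) := ex; rewrite !ordM ?mulf_neq0 //.
by have := @vr_Op z z0; lia.
Qed.
End ValuationRing.

(** * Quadratic forms and their Hessian matrices *)

Section Forms2.
Variables (F : fieldExtType rat) (P : prime_idealr (ring_of_integers F)).
Variable K : completion P.
Variable n : nat.
Implicit Types (Q : {mpoly K[n]}) (H M : 'M[K]_n).

Lemma meval0_mcoeff (p : {mpoly K[n]}) : p.@[fun=> 0] = p@_0%MM.
Proof.
rewrite [p in LHS]mpolyE [p in RHS]mpolyE !raddf_sum /=; apply: eq_bigr => m _.
rewrite mevalZ mevalX mcoeffZ mcoeffX; congr (_ * _).
case: eqP => [->|/eqP m0]; first by rewrite big1 // => i _; rewrite mnm0E expr0.
have [i mi] : exists i, m i != 0%N.
  case: (boolP [exists i, m i != 0%N]) => [/existsP//|].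
  rewrite negb_exists => /forallP h; case/eqP: m0; apply/mnmP => i.
  by rewrite mnm0E; apply/eqP; rewrite -[_ == _]negbK; apply: h.
by rewrite (bigD1 i) //= expr0n (negPf mi) mul0r.
Qed.

Lemma hessian_coeff Q i j :
  hessian Q i j = Q@_(U_(i) + U_(j))%MM *+ (i == j).+1.
Proof.
rewrite mxE meval0_mcoeff !mcoeff_deriv add0m mnm0E mulr1n addmC mnm1E.
by rewrite eq_sym.
Qed.

Lemma hessian_sym Q : (hessian Q)^T = hessian Q.
Proof. by apply/matrixP => i j; rewrite mxE !hessian_coeff addmC eq_sym. Qed.

Lemma mdeg2P (m : 'X_{1..n}) : mdeg m = 2%N -> exists i j, m = (U_(i) + U_(j))%MM.
Proof.
move=> m2; have [i mi] : exists i, m i != 0%N.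
  case: (boolP [exists i, m i != 0%N]) => [/existsP//|].
  rewrite negb_exists => /forallP h; move: m2; rewrite mdegE big1 // => i _.
  by apply/eqP; rewrite -[_ == _]negbK; apply: h.
have e : m = (U_(i) + (m - U_(i)))%MM by rewrite addmC submK // lep1mP.
have : mdeg (m - U_(i)) == 1%N.
  by move: m2; rewrite {1}e mdegD mdeg1 add1n => -[] /eqP.
by move/mdeg1P => [j /eqP ej]; exists i, j; rewrite e ej.
Qed.

(** Hessian entries are coefficients multiplied by 1 or 2, and 2 is nonzero in [K]. Identities
    between forms can thus be checked on Hessian matrices. *)
Lemma hessian_inj Q Q' : Q \is 2.-homog -> Q' \is 2.-homog ->
  hessian Q = hessian Q' -> Q = Q'.
Proof.
move=> hQ hQ' eH; apply/mpolyP => m.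
have [/mdeg2P[i [j ->]]|m2] := eqVneq (mdeg m) 2%N; last first.
  by rewrite (dhomog_nemf_coeff hQ m2) (dhomog_nemf_coeff hQ' m2).
have : hessian Q i j = hessian Q' i j by rewrite eH.
rewrite 2!hessian_coeff -[LHS]mulr_natr -[RHS]mulr_natr.
by apply: mulIf; apply: natrS_neq0.
Qed.

(** The inverse of [hessian], which writes any quadratic form as an explicit sum of products of two
    variables. *)
Definition form_of H : {mpoly K[n]} :=
  \sum_i \sum_j (H i j / 2%:R) *: ('X_i * 'X_j).

Lemma form_of_homog H : form_of H \is 2.-homog.
Proof.
apply: rpred_sum => i _; apply: rpred_sum => j _; apply: rpredZ.
by rewrite -mpolyXD dhomogX /= mdegD !mdeg1.
Qed.

Lemma hessian_form_of H : H^T = H -> hessian (form_of H) = H.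
Proof.
move=> sH; apply/matrixP => a b.
have deltaE (G : 'I_n -> 'I_n -> K) c d :
    \sum_i \sum_j G i j * ((i == c)%:R * (j == d)%:R) = G c d.
  rewrite (bigD1 c) //= (bigD1 d) //= !eqxx !mulr1 !big1 ?addr0 //.
    by move=> i /negPf ic; rewrite big1 // => j _; rewrite ic mul0r mulr0.
  by move=> j /negPf jd; rewrite jd !mulr0.
have -> : hessian (form_of H) a b =
    \sum_i \sum_j (H i j / 2%:R) * ((i == a)%:R * (j == b)%:R) +
    \sum_i \sum_j (H i j / 2%:R) * ((i == b)%:R * (j == a)%:R).
  rewrite mxE /form_of (raddf_sum (mderiv a)) (raddf_sum (mderiv b)) raddf_sum.
  rewrite -big_split; apply: eq_bigr => i _ /=.
  rewrite (raddf_sum (mderiv a)) (raddf_sum (mderiv b)) raddf_sum.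
  rewrite -big_split; apply: eq_bigr => j _ /=.
  rewrite -mulrDr !mderivZ mevalZ; congr (_ * _).
  rewrite mderivM !mderivXU mderivD !mderivM !mderivXU !mderivC.
  by rewrite mul0r mulr0 addr0 add0r mevalD !mevalM !mevalC.
rewrite !deltaE (_ : H b a = H a b); last by rewrite -{2}sH mxE.
have two0 : (2%:R : K) != 0 by exact: natrS_neq0.
by field.
Qed.

Lemma form_ofK Q : Q \is 2.-homog -> form_of (hessian Q) = Q.
Proof.
move=> hQ; apply: hessian_inj => //; first exact: form_of_homog.
by rewrite hessian_form_of // hessian_sym.
Qed.

Lemma meval_hessian Q (v : 'cV[K]_n) : Q \is 2.-homog ->
  Q.@[fun i => v i 0] = qval (2%:R^-1 *: hessian Q) v.
Proof.
move=> hQ; rewrite -[in LHS](form_ofK hQ) qvalE raddf_sum.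
apply: eq_bigr => i _; rewrite raddf_sum; apply: eq_bigr => j _.
by rewrite /= mevalZ mevalM !mevalXU [in RHS]mxE mulrA [2%:R^-1 * _]mulrC.
Qed.

Lemma form_subst_homog Q M : Q \is 2.-homog -> form_subst Q M \is 2.-homog.
Proof.
move=> hQ; rewrite -(form_ofK hQ) /form_subst /form_of raddf_sum.
apply: rpred_sum => i _; rewrite raddf_sum; apply: rpred_sum => j _.
rewrite /= comp_mpolyZ rmorphM /= !comp_mpolyXU -!tnth_nth !tnth_mktuple.
apply: rpredZ; apply: (@dhomogM _ _ _ 1 _ 1).
  by apply: rpred_sum => a _; apply: rpredZ; rewrite dhomogX /= mdeg1.
by apply: rpred_sum => a _; apply: rpredZ; rewrite dhomogX /= mdeg1.
Qed.
End Forms2.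

(** * Genera *)

Section Genus.
Variables (F : fieldExtType rat) (P : prime_idealr (ring_of_integers F)).
Variable K : completion P.
Notation R := (valuation_ring K).
Notation vmx := (map_mx (val : R -> K)).

Lemma vmx_inj m n : injective (fun A : 'M[R]_(m, n) => vmx A).
Proof.
move=> A B /matrixP e; apply/matrixP => i j; apply: val_inj.
by have := e i j; rewrite !mxE.
Qed.

Lemma vmx_lift m n (A : 'M[K]_(m, n)) : (forall i j, Op (A i j)) ->
  exists A', A = vmx A'.
Proof.
move=> hA; exists (\matrix_(i, j) insubd 0 (A i j)); apply/matrixP => i j.
by rewrite !mxE val_insubd ifT //; apply/OpP.
Qed.

Lemma vmx_Op m n (A : 'M[R]_(m, n)) i j : Op (vmx A i j).
Proof. by rewrite mxE; apply: vr_Op. Qed.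

Lemma vmx_GL n (M : 'M[R]_n) : M \in unitmx -> GL_Op (vmx M).
Proof.
move=> uM; have e : vmx M *m vmx (invmx M) = 1%:M.
  by rewrite -map_mxM mulmxV // map_mx1.
have [uv _] := mulmx1_unit e.
have ei : invmx (vmx M) = vmx (invmx M).
  by rewrite -[RHS]mul1mx -(mulVmx uv) -mulmxA e mulmx1.
by split=> // i j; rewrite ?ei; apply: vmx_Op.
Qed.

Lemma GL_vmx n (M : 'M[K]_n) : GL_Op M -> exists2 M', M' \in unitmx & M = vmx M'.
Proof.
move=> [uM /vmx_lift[M' eM] /vmx_lift[N' eN]]; exists M' => //.
have : M' *m N' = 1%:M by apply: vmx_inj; rewrite map_mxM -eM -eN mulmxV // map_mx1.
by case/mulmx1_unit.
Qed.

Lemma genus_sub n (Q1 Q2 : {mpoly K[n]}) (M : 'M[R]_n) :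
  Q1 \is 2.-homog -> Q2 \is 2.-homog -> M \in unitmx ->
  hessian Q2 = (vmx M)^T *m hessian Q1 *m vmx M -> genus Q2 `<=` genus Q1.
Proof.
move=> h1 h2 uM eH _ [_ /GL_vmx[N uN ->] <-].
exists (vmx (M *m N)); first by apply: vmx_GL; rewrite unitmx_mul uM.
apply: hessian_inj; try exact: form_subst_homog.
by rewrite !hessian_subst eH map_mxM trmx_mul !mulmxA.
Qed.

Lemma genus_eq n (Q1 Q2 : {mpoly K[n]}) (M : 'M[R]_n) :
  Q1 \is 2.-homog -> Q2 \is 2.-homog -> M \in unitmx ->
  hessian Q2 = (vmx M)^T *m hessian Q1 *m vmx M -> genus Q1 = genus Q2.
Proof.
move=> h1 h2 uM eH; apply/seteqP; split; last exact: (genus_sub _ _ uM).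
apply: (@genus_sub _ _ _ (invmx M)) => //; first by rewrite unitmx_inv.
rewrite eH !map_trmx !mulmxA -map_mxM -trmx_mul mulmxV // trmx1 map_mx1 mul1mx.
by rewrite -mulmxA -map_mxM mulmxV // map_mx1 mulmx1.
Qed.

Lemma genus_refl n (Q : {mpoly K[n]}) : Q \is 2.-homog -> genus Q Q.
Proof.
move=> h; exists (vmx 1%:M); first by apply: vmx_GL; apply: unitmx1.
apply: hessian_inj => //; first exact: form_subst_homog.
by rewrite hessian_subst map_mx1 trmx1 mul1mx mulmx1.
Qed.

(** Polarization: the values at basis vectors are the halved diagonal entries, and those at sums of
    two basis vectors give the other entries, so all of them are integral. *)
Lemma Op_valued_even n (Q : {mpoly K[n]}) : Q \is 2.-homog -> Op_valued Q ->
  exists2 H : 'M[R]_n, even_mx H & hessian Q = vmx H.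
Proof.
move=> hQ vQ; have mQ := meval_hessian _ hQ; have hs := hessian_sym Q.
set H := hessian Q in mQ hs *.
pose q (v : 'cV[K]_n) := qval (2%:R^-1 *: H) v.
have qOp (v : 'cV[K]_n) : (forall i, Op (v i 0)) -> Op (q v).
  by move=> hv; apply: vQ; exists (fun i => v i 0) => //; rewrite meval_hessian.
have sH i j : H i j = H j i by rewrite -[in LHS]hs mxE.
clearbody H.
have two0 : (2%:R : K) != 0 by exact: natrS_neq0.
have dOp i j : Op ((delta_mx i 0 : 'cV[K]_n) j 0).
  by rewrite mxE andbT; case: eqP => _; [exact: Op1 | rewrite /Op /= /val_ge eqxx].
have qd i : q (delta_mx i 0) = H i i / 2%:R.
  by rewrite /q -[qval _ _]/(bilin _ _ _) bilin_delta mxE mulrC.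
have diagOp i : Op (H i i / 2%:R) by rewrite -qd; apply: qOp.
have HOp i j : Op (H i j).
  have : q (delta_mx i 0 + 1 *: delta_mx j 0) -
      q (delta_mx i 0) - q (delta_mx j 0) = H i j.
    have eA : 2%:R^-1 *: H + (2%:R^-1 *: H)^T = H.
      apply/matrixP => a b; rewrite !mxE (sH b a).
      by field.
    by rewrite /q qvalDZ eA bilin_delta mulr1 expr1n mulr1; ring.
  move=> <-; apply: OpD; last by apply: OpN; apply: qOp.
  apply: OpD; last by apply: OpN; apply: qOp.
  apply: qOp => l; rewrite mxE scale1r; exact: OpD.
(* The upper triangular matrix of the coefficients of the form, integral and with [A + A^T = H]. *)
pose A := \matrix_(i, j)
  (if (i < j)%N then H i j else if i == j then H i i / 2%:R else 0).
have [A' eA] : exists A', A = vmx A'.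
  apply: vmx_lift => i j; rewrite mxE; case: ifP => // _; case: ifP => // _.
  by rewrite /Op /= /val_ge eqxx.
exists (A' + A'^T); first by exists A'.
rewrite map_mxD -map_trmx -eA; apply/matrixP => i j; rewrite !mxE [j == i]eq_sym.
have [->|ij] := eqVneq i j; first by rewrite ltnn; field.
case: ltngtP => [_|_|/ord_inj e]; rewrite ?addr0 ?add0r //.
by rewrite e eqxx in ij.
Qed.

Hypothesis P_neq0 : exists2 x, x \in P & x != 0.

Lemma vr_classification n (H H' : 'M[R]_n) u :
  even_mx H -> even_mx H' -> semiregular H -> u \is a GRing.unit ->
  \det H' = \det H * u ^+ 2 -> congruent H H'.
Proof.
have [s us hs] := @residue_finite _ _ K P_neq0.
pose k : finFieldType := enumerated us hs.
pose f : {rmorphism R -> k} := @residue F P K : R -> residue_field K.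
have fE x : (f x == 0) = (x \isn't a GRing.unit) by exact: residue_eq0.
apply: (@semiregular_classification R k f).
- by rewrite -(inj_eq val_inj) /=; apply: (@natrS_neq0 _ _ K 1).
- exact: residue_surj.
- by move=> x; rewrite fE negbK.
- move=> a b c fa ub; have [|t ut e] := @vr_hensel2 _ _ K a b c _ ub.
    by rewrite -fE fa.
  by exists t => //; apply/eqP; rewrite fE.
- exact: vr_half_closed.
Qed.

(** * The order of the ideal [h_ideal n] *)

Lemma h_idealE n :
  h_ideal n = [set 2%:R ^+ odd n * a | a in setT] :> set (ring_of_integers F).
Proof.
rewrite /h_ideal; case: (odd n) => //=; apply/seteqP; split=> // x _.
by exists x; rewrite ?expr0 ?mul1r.
Qed.

Lemma prime_exp0 k : prime_exp P k 0.
Proof.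
case: k => [|k] //; exists 0%N, (fun=> 0), (fun=> 0); split; first by case.
by rewrite big_ord0.
Qed.

(** The ideal is generated by [2 ^+ odd n], and [ord_emb] turns membership in powers of [P] into
    inequalities of orders; the cofactors are integral, so they only raise the order. *)
Lemma h_ideal_sub n k :
  h_ideal n `<=` prime_exp P k <-> k%:Z <= ord ((2%:R : K) ^+ odd n).
Proof.
pose t : ring_of_integers F := 2%:R ^+ odd n.
have et : completion_emb K (val t) = 2%:R ^+ odd n.
  by rewrite /t !rmorphXn !rmorph_nat.
have t0 : (2%:R ^+ odd n : K) != 0 by rewrite expf_neq0 //; exact: natrS_neq0.
have ev a : a != 0 -> t * a != 0 /\
    ord (completion_emb K (val (t * a))) =
      ord ((2%:R : K) ^+ odd n) + ord (completion_emb K (val a)).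
  move=> a0; have a0' : completion_emb K (val a) != 0 by rewrite fmorph_eq0.
  have e : completion_emb K (val (t * a)) =
      2%:R ^+ odd n * completion_emb K (val a).
    by rewrite -et -rmorphM.
  rewrite e ordM //; split=> //; apply: contraTneq (mulf_neq0 t0 a0') => ta0.
  by rewrite -e ta0 rmorph0 eqxx.
have one0 : (1 : ring_of_integers F) != 0 by exact: oner_neq0.
rewrite h_idealE; split=> [h|h _ [a _ <-]].
  have [t10 <-] : t * 1 != 0 /\
      ord (completion_emb K (val (t * 1))) = ord ((2%:R : K) ^+ odd n).
    by have [? ->] := ev _ one0; rewrite !rmorph1 ord_one addr0.
  by apply/(ord_emb _ _ t10); apply: h; exists 1.
have [->|a0] := eqVneq a 0; first by rewrite mulr0; exact: prime_exp0.
have [ta0 e] := ev _ a0; apply/(ord_emb K _ ta0); rewrite e.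
have : 0%:Z <= ord (completion_emb K (val a)) by apply/(ord_emb K _ a0).
by move=> ?; apply: le_trans h _; rewrite lerDl.
Qed.

Lemma ord_h_ideal n : (ord_ideal P (h_ideal n))%:Z = ord ((2%:R : K) ^+ odd n).
Proof.
have : (0%:Z <= ord ((2%:R : K) ^+ odd n)) by apply/h_ideal_sub.
case e : (ord _) => [m|//] _; rewrite /ord_ideal.
have hm : [set k | h_ideal n `<=` prime_exp P k /\
                   ~ (h_ideal n `<=` prime_exp P k.+1)] m.
  split; first by apply/h_ideal_sub; rewrite e.
  by move/h_ideal_sub; rewrite e lez_nat ltnn.
case: xgetP => [k _ [/h_ideal_sub + hk]|/(_ m)//].
(* The chosen [k] is at most [m] by the inclusion in the [k]-th power, and at least [m] by the
   failure for [k.+1]. *)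
rewrite e lez_nat => km; congr Posz; apply/eqP; rewrite eqn_leq km /= leqNgt.
by apply/negP => mk; apply: hk; apply/h_ideal_sub; rewrite e lez_nat.
Qed.

Lemma Op_unit_lift x : Op_unit x -> exists2 u : R, u \is a GRing.unit & val u = x.
Proof.
move=> [x0 /OpP hx /OpP hx']; exists (ValuationRing hx) => //.
by apply/andP.
Qed.

Lemma ord0_unit (x : K) : x != 0 -> ord x = 0 -> Op_unit x.
Proof.
by move=> x0 e; split=> // _; rewrite ?ordV // e.
Qed.

(** The condition on the order makes the determinant [2 ^+ odd n] times a unit, which is
    semiregularity; equality of the square classes provides the unit [u] for [vr_classification]. *)
Lemma genus_unique n (Q1 Q2 : {mpoly K[n]}) :
  Q1 \is 2.-homog -> Q2 \is 2.-homog ->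
  Op_valued Q1 -> Op_valued Q2 -> \det (hessian Q1) != 0 ->
  ord (\det (hessian Q1)) = ord ((2%:R : K) ^+ odd n) ->
  det_H Q2 = det_H Q1 -> genus Q1 = genus Q2.
Proof.
move=> h1 h2 v1 v2 d0 od eD.
have [H1 eH1 E1] := Op_valued_even h1 v1; have [H2 eH2 E2] := Op_valued_even h2 v2.
have : det_H Q1 (\det (hessian Q2)) by rewrite -eD; apply: sq_class_refl.
move=> [_ /Op_unit_lift[u uu <-] ed].
have two0 : (2%:R ^+ odd n : K) != 0 by rewrite expf_neq0 //; exact: natrS_neq0.
have [|w uw ew] := @Op_unit_lift (\det (hessian Q1) / 2%:R ^+ odd n).
  by apply: ord0_unit; rewrite ?mulf_neq0 ?ordM ?invr_neq0 ?ordV ?od ?subrr.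
have [||M uM eM] := @vr_classification n H1 H2 u eH1 eH2 _ uu.
- exists w => //; apply: val_inj; rewrite -det_map_mx -E1 rmorphM rmorphXn rmorph_nat.
  by rewrite /=; move: ew => /= ->; rewrite mulrC mulfVK.
- by apply: val_inj; rewrite rmorphM rmorphXn -!det_map_mx -E1 -E2 ed.
apply: (genus_eq h1 h2 uM); rewrite E2 eM E1 !map_mxM.
by rewrite map_trmx.
Qed.
End Genus.

Theorem theorem2p6 (F : fieldExtType rat)
    (P : prime_idealr (ring_of_integers F))
    (P_neq0 : exists2 x, x \in P & x != 0)
    (Fp : completion P) (n : nat) (S : set Fp) :
  SqCl S -> ord_SqCl S = (ord_ideal P (h_ideal n))%:Z ->
  is_subset1 [set G : set {mpoly Fp[n]} |
    primitive_genus G /\ det_H_genus G = S].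
Proof.
move=> sS; rewrite (ord_h_ideal Fp) => oS.
move=> _ _ [[Q1 [h1 [v1 _]] <-] d1] [[Q2 [h2 [v2 _]] <-] d2].
(* [det_H_genus] uses a chosen member of the genus; as [Q1] is a member too, it can be computed on
   [Q1]. *)
rewrite (det_H_genusE (genus_refl h1)) in d1.
rewrite (det_H_genusE (genus_refl h2)) in d2.
(* The determinant represents the class [S], so it is nonzero and has the order of [S]. *)
have S1 : S (\det (hessian Q1)) by rewrite -d1; exact: sq_class_refl.
apply: genus_unique => //; last by rewrite d1.
  move: sS S1 => [y /= y0 <-] [u [u0 _ _] <-].
  by rewrite mulf_neq0 ?expf_neq0.
by rewrite -oS (ord_SqClE sS S1).
Qed.
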